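(* Let $r$ be a positive integer and let $u_1, \dots, u_m \in \mathbb{C}^d$ be vectors such that $$\sum_{i=1}^m u_i u_i^* = I$$ and $\|u_i\|^2 \le \delta$ for all $i$. Then there exists a partition $\{S_1, \dots, S_r\}$ of $\{1,\dots,m\}$ (parts allowed to be empty) such that $$\left\| \sum_{i\in S_j} u_i u_i^{*} \right\| \le \left( \frac{1}{\sqrt{r}} + \sqrt{\delta} \right)^2 \quad \text{for } j = 1,\dots,r.$$
   Context: For a vector $x$, $\|x\|$ is the Euclidean norm; for a matrix $M$, $\|M\| = \max_{\|x\|=1}\|Mx\|$ is the operator norm. $I$ is the $d\times d$ identity matrix and $u^*$ is the conjugate transpose of the column vector $u$. An empty sum of matrices is the zero matrix. *)

(* Defs.v *)
From HB Require Import structures.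
From mathcomp Require Import all_boot all_order all_algebra.
From mathcomp Require Import complex.
From mathcomp Require Import all_classical all_reals all_analysis.

Set Implicit Arguments.
Unset Strict Implicit.
Unset Printing Implicit Defensive.

Import Order.TTheory GRing.Theory Num.Theory.
Import numFieldNormedType.Exports.

Local Open Scope classical_set_scope.
Local Open Scope ring_scope.

Definition enorm (R : realType) (d : nat) (x : 'cV[R[i]]_d) : R :=
  Num.sqrt (\sum_(k < d) Normc.normc (x k 0) ^+ 2).

(* For 0 < d this supremum is a maximum (see opnorm_max); for d = 0 the unit
   sphere is empty and sup set0 = 0, the norm of the empty matrix. *)
Definition opnorm (R : realType) (d : nat) (M : 'M[R[i]]_d) : R :=
  sup [set enorm (M *m x) | x in [set x : 'cV[R[i]]_d | enorm x = 1]].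

Section OpnormMax.
Variables (R : realType) (d : nat).
Implicit Types (M : 'M[R[i]]_d) (x : 'cV[R[i]]_d) (v : 'rV[R]_(d + d)).

Let emb v : 'cV[R[i]]_d :=
  \col_k Complex (v 0 (lshift d k)) (v 0 (rshift d k)).

Let emb_surj x : exists v, emb v = x.
Proof.
exists (row_mx (\row_k complex.Re (x k 0)) (\row_k complex.Im (x k 0))).
apply/matrixP => k j; rewrite ord1 mxE row_mxEl row_mxEr !mxE.
by case: (x k 0).
Qed.

Let normc2 (z : R[i]) :
  Normc.normc z ^+ 2 = complex.Re z ^+ 2 + complex.Im z ^+ 2.
Proof. by case: z => a b /=; rewrite sqr_sqrtr// addr_ge0// sqr_ge0. Qed.

Let continuous_sum n (F : 'I_n -> 'rV[R]_(d + d) -> R) :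
  (forall k, continuous (F k)) -> continuous (fun v => \sum_(k < n) F k v).
Proof. by move=> cF; apply: continuous_big => // ; exact: add_continuous. Qed.

Let continuous_coord (i : 'I_(d + d)) :
  continuous (fun v : 'rV[R]_(d + d) => v 0 i).
Proof. exact: coord_continuous. Qed.

Let continuous_enorm M : continuous (fun v => enorm (M *m emb v)).
Proof.
have ReE (z w : R[i]) : complex.Re (z * w) =
    complex.Re z * complex.Re w - complex.Im z * complex.Im w.
  by case: z => a b; case: w.
have ImE (z w : R[i]) : complex.Im (z * w) =
    complex.Re z * complex.Im w + complex.Im z * complex.Re w.
  by case: z => a b; case: w.
have sumRe (F : 'I_d -> R[i]) :
    complex.Re (\sum_j F j) = \sum_j complex.Re (F j).
  by apply: (big_morph _ _ (erefl _)); case=> a b; case.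
have sumIm (F : 'I_d -> R[i]) :
    complex.Im (\sum_j F j) = \sum_j complex.Im (F j).
  by apply: (big_morph _ _ (erefl _)); case=> a b; case.
move=> v; apply: (@continuous_comp _ _ _ _ (@Num.sqrt R)); last first.
  exact: sqrt_continuous.
move: v; apply: continuous_sum => k.
rewrite (_ : (fun v => _) = fun v =>
   (\sum_(j < d) (complex.Re (M k j) * v 0 (lshift d j) -
                  complex.Im (M k j) * v 0 (rshift d j))) ^+ 2 +
   (\sum_(j < d) (complex.Re (M k j) * v 0 (rshift d j) +
                  complex.Im (M k j) * v 0 (lshift d j))) ^+ 2); last first.
  apply/funext => v; rewrite normc2 !mxE sumRe sumIm.
  by congr (_ ^+ 2 + _ ^+ 2); apply: eq_bigr => j _; rewrite !mxE (ReE, ImE).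
have cD (f g : 'rV[R]_(d + d) -> R) : continuous f -> continuous g ->
    continuous (fun v => f v + g v).
  by move=> cf cg v; exact: (cvgD (cf v) (cg v)).
have cM (f g : 'rV[R]_(d + d) -> R) : continuous f -> continuous g ->
    continuous (fun v => f v * g v).
  by move=> cf cg v; exact: (cvgM (cf v) (cg v)).
have cZ (a : R) i : continuous (fun v : 'rV[R]_(d + d) => a * v 0 i).
  by apply: cM; [exact: cst_continuous | exact: continuous_coord].
have cZN (a : R) i : continuous (fun v : 'rV[R]_(d + d) => - (a * v 0 i)).
  by move=> v; exact: (cvgN (cZ a i v)).
by apply: (cD (fun v => (\sum_j _) ^+ 2) (fun v => (\sum_j _) ^+ 2)); apply: cM;
  apply: continuous_sum => j; apply: cD.
Qed.

Lemma opnorm_max M : (0 < d)%N ->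
  (exists2 x, enorm x = 1 & enorm (M *m x) = opnorm M) /\
  (forall x, enorm x = 1 -> enorm (M *m x) <= opnorm M).
Proof.
move=> d_gt0; pose S := [set v | enorm (emb v) = 1].
have S0 : S !=set0.
  have [v vE] := emb_surj (\col_k (k == Ordinal d_gt0)%:R).
  exists v; rewrite /S /= vE /enorm (bigD1 (Ordinal d_gt0))//= big1.
    by rewrite !mxE eqxx normc2 /= expr1n expr0n addr0 addr0 sqrtr1.
  by move=> k /negPf kn; rewrite !mxE kn normc2 /= expr0n addr0.
have Scl : closed S.
  have /continuous_closedP/(_ _ (@closed_eq R 1)) := @continuous_enorm 1%:M.
  by congr closed; apply/funext => v; rewrite /= mul1mx.
have Sco : compact S.
  apply: (subclosed_compact Scl); first exact:
    (@rV_compact R _ (fun=> `[-1, 1]%classic) (fun=> @segment_compact _ _ _)).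
  move=> v vS i /=; rewrite in_itv /= -ler_norml -(@ler_pXn2r _ 2)//= ?nnegrE//.
  have s1 : \sum_(k < d) Normc.normc (emb v k 0) ^+ 2 = 1.
    have := congr1 (fun a => a ^+ 2) vS.
    by rewrite /= sqr_sqrtr ?expr1n// sumr_ge0// => k _; exact: sqr_ge0.
  rewrite real_normK ?num_real// expr1n -s1.
  rewrite -(splitK i).
  suff H k : v 0 (lshift d k) ^+ 2 <= \sum_(k < d) Normc.normc (emb v k 0) ^+ 2
     /\ v 0 (rshift d k) ^+ 2 <= \sum_(k < d) Normc.normc (emb v k 0) ^+ 2.
    by case: (fintype.split i) => k; have [] := H k.
  rewrite (bigD1 k)//= normc2 !mxE /=.
  set T := \sum_(_ < _ | _) _.
  have T0 : 0 <= T by apply: sumr_ge0 => ? _; exact: sqr_ge0.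
  by split; [rewrite -addrA lerDl | rewrite addrAC lerDr];
    rewrite addr_ge0// sqr_ge0.
have [c cS cmax] := compact_EVT_max S0 Sco
  (continuous_subspaceT (continuous_enorm (M := M))).
rewrite inE in cS.
have ub : ubound [set enorm (M *m x) | x in [set x | enorm x = 1]]
    (enorm (M *m emb c)).
  move=> _ [x x1 <-]; have [v vx] := emb_surj x; rewrite -vx.
  by apply: cmax; rewrite inE /S /= vx.
have H x : enorm x = 1 -> enorm (M *m x) <= opnorm M.
  move=> x1; apply: ub_le_sup; last by exists x.
  by exists (enorm (M *m emb c)).
split=> //; exists (emb c) => //; apply/eqP; rewrite eq_le H//=.
by apply: ge_sup => //; exists (enorm (M *m emb c)); exists (emb c).
Qed.

End OpnormMax.

(* Main.v *)
(* The interlacing argument of Marcus, Spielman and Srivastava. Put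
   A_i = u_i u_i^* and F(Z) = prod_j det (sum_i Z_ij A_i) for an m x r matrix Z.
   As the A_i have rank one, F is multiaffine, and it has no zero with all
   Im Z_ij > 0. For f : {1..m} -> {1..r}, the value of F at x - r sum_i e_(i, f i)
   is the product over j of the characteristic polynomials of
   r sum_(f i = j) A_i at x, so we look for an f making it positive for all
   x >= (1 + e)^2, where e = sqrt (r delta).

   Averaging over the choice of f i for one i preserves real stability, for any
   probability weights. Hence the polynomials on the segment from the uniform
   average to any of its terms are real-rooted, and some term has all its roots
   below any bound valid for the average. It remains to bound the roots of the
   average over all f.

   On multiaffine functions the uniform average over row k is G |-> G - D_k G,
   D_k = sum_j d/dZ_kj. Stability makes s |-> (D_i G / G)(Z + s W) map the upper
   half-plane to the lower one; if Z lies above the zeros of G and W >= 0 it is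
   therefore c + sum_l a_l / (s - rho_l) with a_l >= 0 and rho_l < 0, hence
   decreasing and convex for s >= 0. By convexity, if D_k G / G <= 1 - 1/(1 + e)
   at Z, then passing from G to G - D_k G and from Z to Z + (1 + e) sum_j e_kj
   keeps Z above the zeros and increases no barrier D_i G / G. Starting from F at
   the constant matrix e + e^2, where the barriers are at most e / (1 + e), we
   end at the constant matrix (1 + e)^2. *)

Require Import Defs.
From HB Require Import structures.
From mathcomp Require Import all_boot all_order all_algebra.
From mathcomp Require Import complex.
From mathcomp Require Import all_classical all_reals all_analysis.
From mathcomp Require Import ring.

Set Implicit Arguments.
Unset Strict Implicit.
Unset Printing Implicit Defensive.

Import Order.TTheory GRing.Theory Num.Theory.

Local Open Scope ring_scope.
Local Open Scope sesquilinear_scope.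

(** * Polynomial pairs whose quotient exchanges the half-planes *)

Lemma Im_le_norm (C : numClosedFieldType) (z : C) : 'Im z <= `|z|.
Proof.
have -> : 'Im z = 'Re (- 'i * z) by rewrite mulNr raddfN /= ReMil opprK.
by rewrite -[`|z|]mul1r -(@normCi C) -normrN -normrM; case: (leif_Re_Creal (- 'i * z)).
Qed.

(** An algebraic substitute for continuity at [0], through which sign conditions pass to the
    limit. *)
Lemma horner_lipschitz0 (C : numClosedFieldType) (p : {poly C}) :
  exists2 B, 0 < B & forall x, `|x| <= 1 -> `|p.[x] - p.[0]| <= B * `|x|.
Proof.
elim/poly_ind: p => [|p c [B B0 IH]].
  by exists 1 => // x _; rewrite !horner0 subrr normr0 mul1r normr_ge0.
exists (`|p.[0]| + B) => [|x x1]; first by rewrite ltr_wpDl.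
rewrite !hornerMXaddC mulr0 add0r addrK normrM.
apply: ler_wpM2r; rewrite ?normr_ge0 // -[p.[x]](subrK p.[0]) addrC.
rewrite (le_trans (ler_normD _ _)) // lerD2l (le_trans (IH x x1)) //.
by rewrite -[leRHS]mulr1 ler_wpM2l // ltW.
Qed.

Lemma Im_horner0_le0 (C : numClosedFieldType) (p : {poly C}) (e : C) :
  0 < e -> (forall x, 0 < x -> x < e -> 'Im p.[x] <= 0) -> 'Im p.[0] <= 0.
Proof.
move=> e0 H; rewrite real_leNgt ?Creal_Im ?real0 //; apply/negP => d0.
have [B B0 HB] := horner_lipschitz0 p.
set d := 'Im p.[0] in d0.
(* The reciprocal of this sum lies below [1], [e] and [d / B] at once. *)
pose y := 1 + e^-1 + B / d; pose x := y^-1.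
have e'0 : 0 < e^-1 by rewrite invr_gt0.
have Bd0 : 0 < B / d by rewrite divr_gt0.
have y0 : 0 < y by rewrite !addr_gt0.
have x0 : 0 < x by rewrite invr_gt0.
have xe : x < e.
  rewrite -[e]invrK ltf_pV2 ?posrE // /y addrAC ltrDr addr_gt0 //.
have x1 : x < 1.
  by rewrite -[ltRHS]invr1 ltf_pV2 ?posrE // /y -addrA ltrDl addr_gt0.
have Bx : B * x < d.
  have xd : x < d / B.
    by rewrite -[d / B]invrK ltf_pV2 ?posrE ?invr_gt0 ?divr_gt0 // invf_div ltrDr addr_gt0.
  by rewrite mulrC -ltr_pdivlMr.
have x1' : `|x| <= 1 by rewrite ger0_norm ltW.
have {x1'} Hx := HB x x1'; rewrite [`|x|]ger0_norm ?(ltW x0) // in Hx.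
have := H x x0 xe; apply/negP; rewrite -real_ltNge ?real0 ?Creal_Im //.
have : d - 'Im p.[x] < d.
  rewrite -raddfB /= (le_lt_trans (Im_le_norm _)) // distrC.
  exact: le_lt_trans Hx Bx.
by rewrite gtrBl.
Qed.

(** On the real axis this is the conjugate of [p], so products with conjugates become polynomials
    there and [Im_horner0_le0] applies to them. *)
Definition pconj (C : numClosedFieldType) (p : {poly C}) := map_poly Num.conj p.

Lemma horner_pconj (C : numClosedFieldType) (p : {poly C}) x :
  (pconj p).[x] = (p.[x^*])^*.
Proof. by rewrite -horner_map /= conjCK. Qed.

(* The sign condition on [Q / P] near a zero [r] of [P] of order [k] passes to
   the leading term of [Q / P] at [r]. *)
Lemma Im_leading_term (C : numClosedFieldType) (P1 Q : {poly C}) (r w e : C) k :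
    0 < e ->
    (forall x, 0 < x -> x < e ->
       'Im (Q.[r + x * w] * ((P1 * ('X - r%:P) ^+ k).[r + x * w])^*) <= 0) ->
  'Im (Q.[r] * (P1.[r])^* * (w ^+ k)^*) <= 0.
Proof.
move=> e0 H.
(* For real [x] the product in the hypothesis is [x ^+ k * h.[x]]; dividing by [x ^+ k] before
   letting [x] tend to [0] isolates the leading term. *)
pose h := (Q \Po (r%:P + w *: 'X)) * (pconj P1 \Po ((r^*)%:P + w^* *: 'X)) *
  ((w ^+ k)^*)%:P.
have hE x : x^* = x -> h.[x] = Q.[r + x * w] * (P1.[r + x * w])^* * (w ^+ k)^*.
  move=> xr; rewrite /h !hornerM !horner_comp !hornerD !hornerZ !hornerC hornerX.
  by rewrite horner_pconj rmorphD rmorphM /= !conjCK xr [w * x]mulrC.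
have := @Im_horner0_le0 C h e e0; rewrite hE ?conjC0 // mul0r addr0; apply.
move=> x x0 xe; have xr : x^* = x by rewrite geC0_conj // ltW.
have xk0 : 0 < x ^+ k by rewrite exprn_gt0.
have := H x x0 xe; rewrite hE //.
rewrite hornerM horner_exp hornerXsubC addrAC subrr add0r exprMn.
move=> Hx; rewrite -(pmulr_rle0 _ xk0) -ImMl ?rpredX ?CrealE ?xr //.
apply: le_trans Hx; rewrite !rmorphM !rmorphXn /= ?xr.
by rewrite le_eqVlt; apply/orP; left; apply/eqP; congr ('Im _); ring.
Qed.

Lemma exists_root_upper (C : numClosedFieldType) (z : C) k :
  (1 < k)%N -> z \isn't Num.real -> exists2 w : C, 0 < 'Im w & w ^+ k = z.
Proof.
move=> k1 zr; exists (k.-root z); last by rewrite rootCK // ltnW.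
rewrite lt_neqAle Im_rootC_ge0 // andbT eq_sym; apply/eqP => /Creal_ImP wr.
by move: zr; rewrite -[z](@rootCK C k) ?rpredX // ltnW.
Qed.

(* [Q / P] maps the upper half-plane to the closed lower one, and symmetrically;
   written without division so as to allow zeros of [P]. *)
Definition half_plane_flip (C : numClosedFieldType) (P Q : {poly C}) :=
  (forall s, 0 < 'Im s -> 'Im (Q.[s] * (P.[s])^*) <= 0) /\
  (forall s, 'Im s < 0 -> 0 <= 'Im (Q.[s] * (P.[s])^*)).

(** The powers [w ^+ k] take every value; for [w ^+ k = - 'i * c] the product is ['i] times the
    squared modulus of [c]. *)
Lemma multiple_root_arg (C : numClosedFieldType) (c : C) k :
    (0 < k)%N -> (forall w, 'Im (c * (w ^+ k)^*) <= 0) -> c = 0.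
Proof.
move=> k0 H; apply/eqP; apply/negPn/negP => c0.
have := H (k.-root (('i * c^*)^*)); rewrite rootCK // conjCK.
have -> : c * ('i * c^*) = 'i * (c * c^*) by ring.
rewrite ImMil; apply/negP; rewrite -real_ltNge ?real0 ?Creal_Re //.
rewrite (Creal_ReP _ _) ?mul_conjC_gt0 //.
by apply: ger0_real; rewrite mul_conjC_ge0.
Qed.

Lemma ball_upper (C : numClosedFieldType) (r w : C) : 0 < 'Im r ->
  exists2 e, 0 < e & forall x, 0 < x -> x < e -> 0 < 'Im (r + x * w).
Proof.
move=> r0; have w0 : 0 < 1 + `|w| by rewrite ltr_wpDr.
exists ('Im r / (1 + `|w|)); first by rewrite divr_gt0.
move=> x x0; rewrite ltr_pdivlMr // => xw.
have: - 'Im (x * w) < 'Im r.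
  rewrite -raddfN /= (le_lt_trans (Im_le_norm _)) // normrN normrM (gtr0_norm x0).
  by rewrite (lt_trans _ xw) // ltr_pM2l // ltrDr.
by rewrite -subr_gt0 opprK raddfD.
Qed.

(** The leading term at [r] gives a sign condition in each admissible direction [w]. Around a
    nonreal [r] every direction is admissible, which forces [c = 0]; at a real [r] the two
    half-planes give opposite signs, which forces a simple zero with [c] positive. *)
Lemma flip_root (C : numClosedFieldType) (P Q : {poly C}) r :
    half_plane_flip P Q -> P != 0 -> root P r -> Q.[r] != 0 ->
  r \is Num.real /\
  exists P1, [/\ P = P1 * ('X - r%:P), P1.[r] != 0 & 0 <= Q.[r] / P1.[r]].
Proof.
move=> [hU hL] P0 Pr Qr.
have [k [P1]] := multiplicity_XsubC P r; rewrite P0 /= => P1r PE.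
case: k PE => [|k] PE; first by move: P1r; rewrite -[P1]mulr1 -(expr0 ('X - r%:P)) -PE Pr.
set c := Q.[r] * (P1.[r])^*.
have c0 : c != 0 by rewrite mulf_neq0 ?conjC_eq0.
have lt1 (P' : {poly C}) e w : 0 < e ->
    (forall x, 0 < x -> x < e -> 'Im (P'.[r + x * w] * (P.[r + x * w])^*) <= 0) ->
    'Im (P'.[r] * (P1.[r])^* * (w ^+ k.+1)^*) <= 0.
  by move=> e0 He; apply: (Im_leading_term e0) => x x0 xe; rewrite -PE He.
have rr : 'Im r = 0.
  apply/eqP; rewrite eq_le !real_leNgt ?Creal_Im ?real0 //.
  apply/andP; split.
    apply/negP => r0; move/eqP: c0; apply; apply: (@multiple_root_arg _ _ k.+1) => // w.
    have [e e0 He] := ball_upper w r0.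
    by apply: (lt1 _ e) => // x x0 xe; rewrite hU ?He.
  apply/negP => r0; move/eqP: c0; apply; apply/eqP; rewrite -oppr_eq0; apply/eqP.
  apply: (@multiple_root_arg _ _ k.+1) => // w.
  have r0' : 0 < 'Im (- r) by rewrite raddfN oppr_gt0.
  have [e e0 He] := ball_upper (- w) r0'.
  rewrite -mulNr -hornerN; apply: (lt1 _ e) => // x x0 xe.
  rewrite hornerN mulNr raddfN oppr_le0 hL //.
  by rewrite -oppr_gt0 -raddfN opprD -mulrN He.
split; first exact/Creal_ImP.
have up w : 0 < 'Im w -> 'Im (c * (w ^+ k.+1)^*) <= 0.
  move=> w0; apply: (lt1 _ 1) => // x x0 xe; apply: hU.
  by rewrite raddfD /= rr add0r ImMl ?gtr0_real // mulr_gt0.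
have dn w : 'Im w < 0 -> 'Im (- c * (w ^+ k.+1)^*) <= 0.
  move=> w0; rewrite -mulNr -hornerN; apply: (lt1 _ 1) => // x x0 xe.
  rewrite hornerN mulNr raddfN oppr_le0 hL //.
  by rewrite raddfD /= rr add0r ImMl ?gtr0_real // pmulr_rlt0.
(* The directions [1 + 'i * x] and [1 - 'i * x] tend to [1] from the two half-planes and bound
   ['Im c] from both sides. *)
have cr : c \is Num.real.
  pose h (z c : C) : {poly C} := c%:P * (1 + z *: 'X) ^+ k.+1.
  have hE z d x : x^* = x -> (h z d).[x] = d * ((1 + x * z^*) ^+ k.+1)^*.
    move=> xr; rewrite /h hornerM hornerC horner_exp hornerD hornerZ hornerC hornerX.
    by rewrite rmorphXn rmorphD rmorphM /= conjC1 conjCK xr [x * z]mulrC.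
  apply/Creal_ImP/eqP; rewrite eq_le; apply/andP; split.
    have := @Im_horner0_le0 C (h (- 'i) c) 1 ltr01.
    rewrite hE ?conjC0 // mul0r addr0 expr1n conjC1 mulr1; apply => x x0 _.
    have xr : x^* = x by rewrite geC0_conj // ltW.
    rewrite hE // rmorphN /= conjCi opprK up //.
    by rewrite raddfD /= (Creal_ImP _ (real1 _)) add0r ImMl ?gtr0_real // Im_i mulr1.
  have := @Im_horner0_le0 C (h 'i (- c)) 1 ltr01.
  rewrite hE ?conjC0 // mul0r addr0 expr1n conjC1 mulr1 raddfN oppr_le0; apply => x x0 _.
  have xr : x^* = x by rewrite geC0_conj // ltW.
  rewrite hE // conjCi dn //.
  rewrite raddfD /= (Creal_ImP _ (real1 _)) add0r ImMl ?gtr0_real //.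
  by rewrite raddfN /= Im_i mulrN1 oppr_lt0.
have c2 : 0 < c * c by rewrite -{2}(CrealP cr) mul_conjC_gt0.
(* For a simple zero, the direction ['i] gives [0 <= c]. For higher order, an upper [w] with
   [w ^+ k.+2 = - 'i * c] would give [c * c <= 0]. *)
case: k PE up dn lt1 => [|k] PE up _ _.
  exists P1; split; rewrite ?PE ?expr1 //.
  have -> : Q.[r] / P1.[r] = c / (P1.[r] * (P1.[r])^*).
    by rewrite /c; field; rewrite conjC_eq0 P1r.
  rewrite divr_ge0 ?mul_conjC_ge0 //.
  have := up 'i; rewrite Im_i ltr01 => /(_ isT).
  by rewrite expr1 conjCi mulrN raddfN /= ImMir oppr_le0 (Creal_ReP _ _).
have [w w0 wE] : exists2 w : C, 0 < 'Im w & w ^+ k.+2 = - 'i * c.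
  apply: exists_root_upper => //; apply/negP => /Creal_ImP.
  rewrite mulNr raddfN /= ImMil (Creal_ReP _ cr) => /eqP; rewrite oppr_eq0.
  by apply/negP.
have := up w w0; rewrite wE rmorphM rmorphN /= conjCi opprK (CrealP cr).
rewrite mulrCA ImMil (Creal_ReP _ _) ?gtr0_real //.
by move/(lt_le_trans c2); rewrite ltxx.
Qed.

Lemma Re_horner0_ge0 (C : numClosedFieldType) (p : {poly C}) :
  (forall x, 0 < x -> 0 <= 'Re p.[x]) -> 0 <= 'Re p.[0].
Proof.
move=> H; have E z : 'Im ((- 'i)%:P * p).[z] = - 'Re p.[z].
  by rewrite hornerM hornerC mulNr [LHS]raddfN /= ImMil.
rewrite -oppr_le0 -E; apply: (Im_horner0_le0 ltr01) => x x0 _.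
by rewrite E oppr_le0 H.
Qed.

(* Reversing both polynomials turns the claim into one about a pole at [0]. *)
Lemma flip_size (C : numClosedFieldType) (P Q : {poly C}) :
    half_plane_flip P Q -> (forall s, 0 <= s -> P.[s] != 0) ->
    (forall s, 0 <= s -> 0 <= Q.[s] / P.[s]) ->
  (size Q <= size P)%N.
Proof.
move=> [hU _] hP hQ; rewrite leqNgt; apply/negP => sPQ.
have P0 : P != 0 by apply/eqP => P0; have := hP 0 (lexx _); rewrite P0 horner0 eqxx.
have Q0 : Q != 0 by apply/eqP => Q0; rewrite Q0 size_poly0 in sPQ.
have sP : (0 < size P)%N by rewrite size_poly_gt0.
(* For nonzero [x] this is [p.[w / x]] times [x] to the degree of [p]; its value at [0] records the
   behaviour of [p] at infinity in the direction [w]. *)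
pose rev (p : {poly C}) (w : C) : {poly C} :=
  \sum_(i < size p) (p`_i * w ^+ i) *: 'X^((size p).-1 - i).
have revE p w x : x != 0 -> (rev p w).[x] = p.[w / x] * x ^+ (size p).-1.
  move=> x0; rewrite horner_sum horner_coef mulr_suml; apply: eq_bigr => i _.
  rewrite hornerZ hornerXn expr_div_n -!mulrA; congr (_ * (_ * _)).
  have ip : (i <= (size p).-1)%N.
    by rewrite -ltnS prednK ?ltn_ord // (leq_ltn_trans _ (ltn_ord i)).
  by rewrite expfB_cond // ?(negbTE x0) ?add0n // mulrC.
have rev0 p w : p != 0 -> (rev p w).[0] = lead_coef p * w ^+ (size p).-1.
  move=> p0; have sp : (0 < size p)%N by rewrite size_poly_gt0.
  rewrite horner_sum.
  have lp : ((size p).-1 < size p)%N by rewrite prednK.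
  rewrite (bigD1 (Ordinal lp)) //= big1 ?addr0.
    by rewrite subnn expr0 alg_polyC hornerC.
  move=> i; rewrite -val_eqE /= => ni; rewrite hornerZ hornerXn expr0n subn_eq0.
  have : (i <= (size p).-1)%N by rewrite -ltnS prednK.
  rewrite leq_eqVlt (negbTE ni) /= => ilt.
  by rewrite leqNgt ilt mulr0.
pose e := (size Q).-1; pose n := (size P).-1.
pose h w : {poly C} := rev Q w * pconj (rev P w).
have hE w x : 0 < x -> (h w).[x] = x ^+ (e + n) * (Q.[w / x] * (P.[w / x])^*).
  move=> x0; have xr : x^* = x by rewrite geC0_conj // ltW.
  rewrite hornerM horner_pconj xr !revE ?gt_eqF // rmorphM rmorphXn /= xr exprD.
  rewrite -/e -/n; ring.
have h0 w : (h w).[0] = lead_coef Q * (lead_coef P)^* * (w ^+ e * (w ^+ n)^*).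
  by rewrite hornerM horner_pconj conjC0 !rev0 // rmorphM /= -/e -/n; ring.
have xp x k : 0 < x -> 0 < x ^+ k :> C by move=> x0; rewrite exprn_gt0.
set c := lead_coef Q * (lead_coef P)^* in h0.
have c0 : c != 0 by rewrite mulf_neq0 ?conjC_eq0 ?lead_coef_eq0.
have hr x : 0 < x -> 0 <= (h 1).[x].
  move=> x0; rewrite hE // mulr_ge0 ?(ltW (xp _ _ x0)) //.
  have s0 : 0 <= 1 / x by rewrite divr_ge0 // ltW.
  have -> : Q.[1 / x] * (P.[1 / x])^* = Q.[1 / x] / P.[1 / x] * (P.[1 / x] * (P.[1 / x])^*).
    by field; rewrite hP // gt_eqF.
  by rewrite mulr_ge0 ?mul_conjC_ge0 ?hQ.
have cE : (h 1).[0] = c by rewrite h0 !expr1n conjC1 !mulr1.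
have cr : c \is Num.real.
  apply/Creal_ImP/eqP; rewrite eq_le -cE; apply/andP; split.
    apply: (@Im_horner0_le0 _ _ 1) => // x x0 _.
    by rewrite (Creal_ImP _ (ger0_real (hr x x0))).
  rewrite -oppr_le0 -raddfN -hornerN.
  apply: (@Im_horner0_le0 _ _ 1) => // x x0 _.
  by rewrite hornerN raddfN /= (Creal_ImP _ (ger0_real (hr x x0))) oppr0.
have cp : 0 < c.
  rewrite lt_neqAle eq_sym c0 /= -(Creal_ReP _ cr) -{1}cE.
  apply: Re_horner0_ge0 => x x0.
  by rewrite (Creal_ReP _ _) ?hr // ger0_real // hr.
(* With [c] positive by the direction [1], the limit in an upper direction [w] has the sign of
   ['Im (w ^+ (e - n))]. An upper root of ['i] will contradict this. *)
have key (w : C) : 0 < 'Im w -> 'Im (w ^+ (e - n)) <= 0.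
  move=> w0; have wn0 : w != 0 by apply: contraTneq w0 => ->; rewrite raddf0 ltxx.
  have : 'Im (h w).[0] <= 0.
    apply: (@Im_horner0_le0 _ _ 1) => // x x0 _.
    rewrite hE // ImMl ?gtr0_real ?xp // pmulr_rle0 ?xp // hU //.
    by rewrite mulrC ImMl ?rpredV ?gtr0_real // mulr_gt0 // invr_gt0.
  have en : e = (e - n + n)%N.
    by rewrite subnK // -ltnS !prednK // ltnW // (leq_trans _ sPQ).
  rewrite h0 {1}en exprD -[_ * _ * (w ^+ n)^*]mulrA ImMl // pmulr_rle0 // mulrC ImMl.
    by rewrite pmulr_rle0 // mul_conjC_gt0 expf_neq0.
  by rewrite ger0_real // mul_conjC_ge0.
have en : (0 < e - n)%N by rewrite subn_gt0 -ltnS !prednK // (leq_trans _ sPQ).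
have [w w0 wE] : exists2 w : C, 0 < 'Im w & w ^+ (e - n) = 'i.
  have [e1|] := eqVneq (e - n)%N 1%N; first by exists 'i; rewrite ?Im_i ?e1.
  by move=> n1; apply: exists_root_upper (nonRealCi C); rewrite ltn_neqAle eq_sym n1.
by have := key w w0; rewrite wE Im_i ler10.
Qed.

(** Away from [r] the common factor contributes the positive number [|s - r|^2]. The point [r]
    itself is a limit along the horizontal line through it, which stays in the half-plane. *)
Lemma flip_cancel (C : numClosedFieldType) (P Q : {poly C}) r :
  half_plane_flip (P * ('X - r%:P)) (Q * ('X - r%:P)) -> half_plane_flip P Q.
Proof.
have hE s : (Q * ('X - r%:P)).[s] * ((P * ('X - r%:P)).[s])^* =
    (s - r) * (s - r)^* * (Q.[s] * (P.[s])^*).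
  by rewrite !hornerM !hornerXsubC rmorphM /=; ring.
have re z : z * z^* \is @Num.real C by rewrite ger0_real // mul_conjC_ge0.
move=> [hU hL].
have U s : s != r -> 0 < 'Im s -> 'Im (Q.[s] * (P.[s])^*) <= 0.
  move=> sr s0; have := hU s s0; rewrite hE ImMl // pmulr_rle0 //.
  by rewrite mul_conjC_gt0 subr_eq0.
have L s : s != r -> 'Im s < 0 -> 0 <= 'Im (Q.[s] * (P.[s])^*).
  move=> sr s0; have := hL s s0; rewrite hE ImMl // pmulr_rge0 //.
  by rewrite mul_conjC_gt0 subr_eq0.
have ne (x : C) : 0 < x -> r + x * 1 != r.
  by move=> x0; rewrite -subr_eq0 addrAC subrr add0r mulr1 gt_eqF.
have im x : 0 < x -> 'Im (r + x * 1) = 'Im r.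
  by move=> x0; rewrite mulr1 raddfD /= (Creal_ImP _ (gtr0_real x0)) addr0.
have lead (Q' : {poly C}) :
    (forall x, 0 < x -> 'Im (Q'.[r + x * 1] * (P.[r + x * 1])^*) <= 0) ->
    'Im (Q'.[r] * (P.[r])^*) <= 0.
  move=> H; have : 'Im (Q'.[r] * (P.[r])^* * (1 ^+ 0)^*) <= 0.
    by apply: (Im_leading_term ltr01) => x x0 _; rewrite expr0 (mulr1 P) H.
  by rewrite expr0 conjC1 mulr1.
split=> s s0; (have [sr|] := eqVneq s r; last by auto); subst s.
  by apply: lead => x x0; rewrite U ?ne ?im.
rewrite -oppr_le0 -raddfN -mulNr -hornerN; apply: lead => x x0.
by rewrite hornerN mulNr raddfN oppr_le0 L ?ne ?im.
Qed.

(* After cancelling common roots, the local behaviour of [Q / P] at a pole (and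
   at infinity) forces every pole to be real and simple. *)
Lemma flip_partial_fractions (C : numClosedFieldType) (P Q : {poly C}) :
    half_plane_flip P Q -> (forall s, 0 <= s -> P.[s] != 0) ->
    (forall s, 0 <= s -> 0 <= Q.[s] / P.[s]) ->
  exists (c : C) (a : C -> C) (rs : seq C),
    (forall r, r \in rs -> r < 0 /\ 0 <= a r) /\
    forall s, 0 <= s -> Q.[s] / P.[s] = c + \sum_(r <- rs) a r / (s - r) /\
      (Q.[s] * P^`().[s] - Q^`().[s] * P.[s]) / P.[s] ^+ 2 =
        \sum_(r <- rs) a r / (s - r) ^+ 2.
Proof.
have [N] := ubnP (size P); elim: N P Q => // N IH P Q PN fl hP hQ.
have P0 : P != 0 by apply/eqP => P0; have := hP 0 (lexx _); rewrite P0 horner0 eqxx.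
have deriv_mulX (p : {poly C}) r s :
    (p * ('X - r%:P))^`().[s] = p^`().[s] * (s - r) + p.[s].
  by rewrite derivM derivXsubC mulr1 hornerD hornerM hornerXsubC.
have ratioX (p q s r : C) : p - r != 0 -> q != 0 -> s * (p - r) / (q * (p - r)) = s / q.
  by move=> pr q0; field; rewrite pr q0.
(* Cancelling a common root changes neither [Q / P] nor its derivative on the nonnegative axis. *)
have [/closed_rootP[r]|/negbNE/eqP cop] := boolP (size (gcdp P Q) != 1%N).
  rewrite root_gcd => /andP[/factor_theorem[P1 PE] /factor_theorem[Q1 QE]].
  have hs s : 0 <= s -> P1.[s] != 0 /\ s - r != 0.
    by move=> /hP; rewrite PE hornerM hornerXsubC mulf_eq0 negb_or => /andP[].
  have sP1 : (size P1 < N)%N.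
    move: P0 PN; rewrite PE mulf_eq0 negb_or => /andP[P10 _].
    by rewrite size_Mmonic ?monicXsubC // size_XsubC addn2.
  have fl1 : half_plane_flip P1 Q1 by apply: (@flip_cancel _ _ _ r); rewrite -PE -QE.
  have hP1 s : 0 <= s -> P1.[s] != 0 by move=> /hs[].
  have hQ1 s : 0 <= s -> 0 <= Q1.[s] / P1.[s].
    move=> s0; have [p1 sr] := hs s s0; have := hQ s s0.
    by rewrite PE QE !hornerM !hornerXsubC ratioX.
  have [c [a [rs [rsP sE]]]] := IH P1 Q1 sP1 fl1 hP1 hQ1.
  exists c, a, rs; split=> // s s0; have [p1 sr] := hs s s0.
  have [<- <-] := sE s s0; rewrite PE QE !deriv_mulX !hornerM !hornerXsubC.
  by split; field; rewrite p1 sr.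
have [rs PE] := closed_field_poly_normal P.
set l := lead_coef P in PE; have l0 : l != 0 by rewrite lead_coef_eq0.
pose Pd r := l *: \prod_(z <- rem r rs) ('X - z%:P).
have PdE r : r \in rs -> P = Pd r * ('X - r%:P).
  by move=> rrs; rewrite {1}PE (perm_big _ (perm_to_rem rrs)) big_cons /Pd -scalerAl mulrC.
have Prs r : (r \in rs) = root P r by rewrite PE rootZ // root_prod_XsubC.
have rsP r : r \in rs -> [/\ r < 0, (Pd r).[r] != 0 & 0 <= Q.[r] / (Pd r).[r]].
  move=> rrs; have Pr : root P r by rewrite -Prs.
  have Qr : Q.[r] != 0.
    apply/negP => Qr; have : root (gcdp P Q) r by rewrite root_gcd Pr.
    by move/root_size_gt1; rewrite cop -size_poly_eq0 cop => /(_ isT).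
  have [rr [P1 [P1E P1r P1ge]]] := flip_root fl P0 Pr Qr.
  have P1d : P1 = Pd r.
    by apply: (mulIf (negbT (polyXsubC_eq0 r))); rewrite -P1E -PdE.
  rewrite -P1d; split=> //; rewrite real_ltNge ?real0 //; apply/negP => r0.
  by have := hP r r0; move/rootP: Pr => ->; rewrite eqxx.
have rem_notin r : r \in rs -> r \notin rem r rs.
  move=> rrs; have [_] := rsP r rrs; rewrite /Pd hornerZ mulf_eq0 negb_or l0 /= => H _.
  by rewrite -root_prod_XsubC.
have urs : uniq rs.
  apply: count_mem_uniq => r; have [rrs|/count_memPn->//] := boolP (r \in rs).
  have /permP-> := perm_to_rem rrs; rewrite /= eqxx.
  by have /count_memPn-> := rem_notin r rrs.
have sP : size P = (size rs).+1 by rewrite PE size_scale // size_prod_XsubC.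
(* [c] is the value of [Q / P] at infinity and [a r] its residue at the simple pole [r]. *)
pose n := size rs; pose c := Q`_n / l; pose a r := Q.[r] / (Pd r).[r].
have sPd r : r \in rs -> size (Pd r) = n.
  move=> rrs; rewrite size_scale // size_prod_XsubC size_rem // prednK //.
  by rewrite lt0n size_eq0; apply: contraTneq rrs => ->.
pose S := \sum_(r <- rs) a r *: Pd r.
have sS : (size S <= n)%N.
  rewrite /S big_seq; apply: (big_ind (fun p : {poly C} => (size p <= n)%N)).
  - by rewrite size_poly0.
  - by move=> p q pn qn; rewrite (leq_trans (size_polyD _ _)) // geq_max pn.
  - by move=> r rrs; rewrite (leq_trans (size_scale_leq _ _)) // sPd.
(* Interpolation: the difference has degree below [n] and vanishes at the [n] distinct zeros of
   [P]. *)
have QE : Q = c *: P + S.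
  apply/eqP; rewrite -subr_eq0; apply/negPn/negP => D0.
  set D := Q - _ in D0.
  have sQ : (size Q <= n.+1)%N by rewrite -sP flip_size.
  have sD : (size D <= n)%N.
    apply/leq_sizeP => j; rewrite leq_eqVlt => /predU1P[<-|nj].
      rewrite coefB coefD coefZ (nth_default 0 sS) addr0.
      have -> : P`_n = l by rewrite /l lead_coefE sP.
      by rewrite divfK // subrr.
    have sPj : (size P <= j)%N by rewrite sP.
    rewrite coefB coefD coefZ (nth_default 0 sPj) (nth_default 0 (leq_trans sQ nj)).
    by rewrite (nth_default 0 (leq_trans sS (ltnW nj))) mulr0 addr0 subrr.
  have := max_poly_roots D0 _ urs; rewrite ltnNge sD => /(_ _)/negP; apply => //.
  apply/allP => r rrs; apply/rootP.
  have /rootP Pr : root P r by rewrite -Prs.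
  rewrite /D hornerD hornerN hornerD hornerZ Pr mulr0 add0r /S horner_sum (bigD1_seq r) //=.
  have [_ Pdr _] := rsP r rrs.
  rewrite hornerZ divfK // big_seq_cond big1 ?addr0 ?subrr // => z /andP[zrs zr].
  rewrite hornerZ; apply/eqP; rewrite mulf_eq0; apply/orP; right.
  by rewrite /Pd -rootE rootZ // root_prod_XsubC mem_rem_uniq // inE eq_sym zr.
exists c, a, rs; split=> [r /rsP[]//|s s0].
have hs r : r \in rs -> (Pd r).[s] != 0 /\ s - r != 0.
  move=> rrs; have := hP s s0.
  by rewrite (PdE r rrs) hornerM hornerXsubC mulf_eq0 negb_or => /andP[].
have Ps := hP s s0; split.
  rewrite {1}QE hornerD hornerZ mulrDl mulfK //; congr (_ + _).
  rewrite horner_sum mulr_suml big_seq [RHS]big_seq; apply: eq_bigr => r rrs.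
  have [p1 sr] := hs r rrs; rewrite hornerZ (PdE r rrs) hornerM hornerXsubC; field.
  by rewrite p1 sr.
(* The expression is linear in [Q] and vanishes on multiples of [P], so only [S] contributes. *)
have -> : Q.[s] * P^`().[s] - Q^`().[s] * P.[s] =
    \sum_(r <- rs) a r * ((Pd r).[s] * P^`().[s] - (Pd r)^`().[s] * P.[s]).
  rewrite QE derivD derivZ !hornerD !hornerZ /S.
  rewrite [(\sum_(_ <- _) _)^`()](raddf_sum (@deriv C)) /= !horner_sum.
  have -> (x y : C) (A B : C) : (c * x + A) * y - (c * y + B) * x = A * y - B * x by ring.
  rewrite !mulr_suml -sumrB; apply: eq_bigr => r _.
  by move: (a r) (Pd r) => x A; rewrite derivZ !hornerZ; ring.
rewrite mulr_suml big_seq [RHS]big_seq; apply: eq_bigr => r rrs.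
have [p1 sr] := hs r rrs; rewrite (PdE r rrs) deriv_mulX !hornerM !hornerXsubC.
by move: (Pd r) p1 => A p1; field; rewrite p1 sr.
Qed.

(** [D] is minus the derivative of [Q / P] at [t]. Each partial fraction is decreasing and convex on
    the nonnegative axis, and the second inequality compares it with its tangent at [t]. *)
Lemma flip_convex (C : numClosedFieldType) (P Q : {poly C}) (s t : C) :
    half_plane_flip P Q -> (forall s, 0 <= s -> P.[s] != 0) ->
    (forall s, 0 <= s -> 0 <= Q.[s] / P.[s]) -> 0 <= s -> s <= t ->
  let D := (Q.[t] * P^`().[t] - Q^`().[t] * P.[t]) / P.[t] ^+ 2 in
  0 <= D /\ (t - s) * D <= Q.[s] / P.[s] - Q.[t] / P.[t].
Proof.
move=> fl hP hQ s0 st; have t0 := le_trans s0 st.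
have [c [a [rs [rsP E]]]] := flip_partial_fractions fl hP hQ.
have [-> _] := E s s0; have [-> ->] := E t t0.
have sr x r : 0 <= x -> r \in rs -> 0 < x - r.
  by move=> x0 /rsP[r0 _]; rewrite subr_gt0 (lt_le_trans r0).
split.
  rewrite big_seq sumr_ge0 // => r rrs; have [_ a0] := rsP r rrs.
  by rewrite divr_ge0 // exprn_ge0 // ltW // sr.
rewrite opprD addrACA subrr add0r -sumrB mulr_sumr big_seq [leRHS]big_seq.
apply: ler_sum => r rrs; have [_ a0] := rsP r rrs.
have s1 := sr s r s0 rrs; have t1 := sr t r t0 rrs.
have -> : a r / (s - r) - a r / (t - r) = (t - s) * (a r / (s - r) / (t - r)).
  by field; rewrite !gt_eqF.
rewrite ler_wpM2l ?subr_ge0 // expr2 invfM mulrA ler_wpM2r ?invr_ge0 ?(ltW t1) //.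
by rewrite ler_wpM2l // lef_pV2 ?posrE // lerB.
Qed.

(** * Segments of real-rooted polynomials *)

Lemma prod_XsubC_coef_gt0 (C : numDomainType) (rs : seq C) i :
    (forall z, z \in rs -> z < 0) -> (i <= size rs)%N ->
  0 < (\prod_(z <- rs) ('X - z%:P))`_i.
Proof.
elim: rs i => [|z rs IH] i rs0; first by rewrite leqn0 big_nil => /eqP->; rewrite coef1.
have z0 : z < 0 by apply: rs0; rewrite mem_head.
have {}IH j : (j <= size rs)%N -> 0 < (\prod_(z <- rs) ('X - z%:P))`_j.
  by apply: IH => y yrs; apply: rs0; rewrite inE yrs orbT.
rewrite big_cons /= mulrBl coefB coefXM coefCM -mulNr => ile.
have {}IH0 j : 0 <= (\prod_(z <- rs) ('X - z%:P))`_j.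
  have [/IH/ltW//|jl] := leqP j (size rs).
  by rewrite nth_default // size_prod_XsubC.
have z0' : 0 < - z by rewrite oppr_gt0.
case: i ile => [|i] ile /=; first by rewrite add0r mulr_gt0 ?IH.
by rewrite ltr_wpDr ?IH // mulr_ge0 // ltW.
Qed.

Lemma prod_XsubC_coef_real (C : numDomainType) (rs : seq C) i :
    (forall z, z \in rs -> z \is Num.real) ->
  (\prod_(z <- rs) ('X - z%:P))`_i \is Num.real.
Proof.
elim: rs i => [|z rs IH] i rsr; first by rewrite big_nil coef1 realn.
have {}IH j : (\prod_(z <- rs) ('X - z%:P))`_j \is Num.real.
  by apply: IH => y yrs; apply: rsr; rewrite inE yrs orbT.
rewrite big_cons /= mulrBl coefB coefXM coefCM rpredB ?rpredM ?(rsr z) ?mem_head //.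
by case: i => [|i] /=; rewrite ?real0 ?IH.
Qed.

Lemma monic_coef_gt0 (C : numClosedFieldType) (p : {poly C}) i :
    p \is monic -> (forall x, root p x -> x < 0) -> (i < size p)%N -> 0 < p`_i.
Proof.
move=> /monicP lp rp; have [rs] := closed_field_poly_normal p.
rewrite lp scale1r => pE; rewrite pE size_prod_XsubC ltnS => ile.
apply: prod_XsubC_coef_gt0 => // z zrs; apply: rp.
by rewrite pE root_prod_XsubC.
Qed.

Lemma horner_coef_gt0 (C : numDomainType) (p : {poly C}) x :
  0 < p`_0 -> (forall i, 0 <= p`_i) -> 0 <= x -> 0 < p.[x].
Proof.
move=> p0 pi x0; rewrite horner_coef; case E: (size p) => [|n].
  by move: p0; rewrite nth_default ?ltxx // E.
rewrite big_ord_recl expr0 mulr1 ltr_wpDr // sumr_ge0 // => i _.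
by rewrite mulr_ge0 // exprn_ge0.
Qed.

(* Follow the segment from [f] to [g] up to the first point where a Taylor
   coefficient at [l] vanishes: the polynomial there is positive beyond [l],
   so by real-rootedness all its Taylor coefficients at [l] are positive. *)
Lemma real_rooted_segment_gt0 (C : numClosedFieldType) (f g : {poly C}) (l : C) :
    f \is monic -> g \is monic -> size f = size g -> l \is Num.real ->
    (forall s, 0 <= s -> s <= 1 ->
       forall x, root ((1 - s) *: f + s *: g) x -> x \is Num.real) ->
    (forall x, l <= x -> 0 < f.[x]) -> 0 < g.[l] ->
  forall x, l <= x -> 0 < g.[x].
Proof.
move=> fm gm sfg lr rr fl gl.
(* Recentring at [l] makes the coefficients of [H s] the Taylor coefficients at [l], which are
   affine in [s]. *)
pose H s := ((1 - s) *: f + s *: g) \Po ('X + l%:P).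
have Hh s x : (H s).[x] = ((1 - s) *: f + s *: g).[x + l].
  by rewrite horner_comp !hornerE.
have sX : size ('X + l%:P) = 2%N by rewrite size_XaddC.
have Hm s : H s \is monic /\ size (H s) = size f.
  have lc : lead_coef ((1 - s) *: f + s *: g) = 1 /\ size ((1 - s) *: f + s *: g) = size f.
    have n0 : (0 < size f)%N by rewrite size_poly_gt0 monic_neq0.
    have cE : ((1 - s) *: f + s *: g)`_(size f).-1 = 1.
      rewrite coefD !coefZ {2}sfg -!lead_coefE (monicP fm) (monicP gm); ring.
    suff sE : size ((1 - s) *: f + s *: g) = size f by rewrite lead_coefE sE.
    apply/eqP; rewrite eqn_leq; apply/andP; split.
      rewrite (leq_trans (size_polyD _ _)) // geq_max !(leq_trans (size_scale_leq _ _)) //.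
      by rewrite sfg.
    rewrite leqNgt -[X in (_ < X)%N]prednK // ltnS; apply/negP => /leq_sizeP/(_ _ (leqnn _)).
    by rewrite cE => /eqP; rewrite oner_eq0.
  split; last by rewrite size_comp_poly2 // lc.2.
  by rewrite monicE lead_coef_comp ?sX // lc.1 lead_coefXaddC expr1n mulr1.
(* Nonnegative coefficients with a positive constant one exclude nonnegative roots; the roots, being
   real, are then negative, which makes every coefficient positive. *)
have Hpos s : 0 <= s -> s <= 1 -> 0 < (H s)`_0 -> (forall i, 0 <= (H s)`_i) ->
    forall i, (i < size f)%N -> 0 < (H s)`_i.
  move=> s0 s1 h0 hi i; have [hm <-] := Hm s; apply: monic_coef_gt0 hm _.
  move=> x xr; have xlr : x + l \is Num.real.
    by apply: (rr s) => //; move: xr; rewrite !rootE Hh.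
  have {}xlr : x \is Num.real by rewrite -[x](addrK l) rpredB.
  rewrite real_ltNge ?real0 //; apply/negP => x0.
  by have := horner_coef_gt0 h0 hi x0; rewrite (rootP xr) ltxx.
have H00 : H 0 = f \Po ('X + l%:P) by rewrite /H subr0 scale1r scale0r addr0.
have H11 : H 1 = g \Po ('X + l%:P) by rewrite /H subrr scale1r scale0r add0r.
have HE s i : (H s)`_i = (1 - s) * (H 0)`_i + s * (H 1)`_i.
  by rewrite H00 H11 /H comp_polyD !comp_polyZ coefD !coefZ.
have F0 i : (i < size f)%N -> 0 < (H 0)`_i.
  have [hm <-] := Hm 0; apply: monic_coef_gt0 hm _ => x xr.
  have xlr : x + l \is Num.real.
    by apply: (rr 0); rewrite ?ler01 //; move: xr; rewrite !rootE Hh.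
  have {}xlr : x \is Num.real by rewrite -[x](addrK l) rpredB.
  rewrite real_ltNge ?real0 //; apply/negP => x0.
  have := fl (x + l); rewrite lerDr x0 => /(_ isT).
  have := rootP xr; rewrite Hh subr0 scale1r scale0r addr0 => ->.
  by rewrite ltxx.
have G0 : 0 < (H 1)`_0.
  by rewrite -horner_coef0 Hh subrr scale0r scale1r !add0r.
have Gr i : (H 1)`_i \is Num.real.
  have [hm _] := Hm 1; have [rs] := closed_field_poly_normal (H 1).
  rewrite (monicP hm) scale1r => HrE.
  rewrite HrE; apply: prod_XsubC_coef_real => z zrs.
  have zlr : z + l \is Num.real.
    apply: (rr 1); rewrite ?ler01 //.
    have : root (H 1) z by rewrite HrE root_prod_XsubC.
    by rewrite !rootE Hh.
  by rewrite -[z](addrK l) rpredB.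
have small i : (size f <= i)%N -> forall s, (H s)`_i = 0.
  by move=> fi s; rewrite nth_default // (Hm s).2.
suff Gpos : forall i, (i < size f)%N -> 0 < (H 1)`_i.
  move=> x lx; have := @horner_coef_gt0 C (H 1) (x - l) G0.
  rewrite Hh subrK subrr scale0r scale1r add0r subr_ge0; apply=> // i.
  by have [/Gpos/ltW|/small->] := ltnP i (size f).
move=> i ilt; rewrite real_ltNge ?real0 //; apply/negP => Gi.
(* [t j] is the parameter where the [j]-th coefficient vanishes. At the least [t j] over the bad
   indices no coefficient is negative yet, so [Hpos] applies there. *)
pose bad (j : 'I_(size f)) := (H 1)`_j <= 0.
pose t (j : 'I_(size f)) := (H 0)`_j / ((H 0)`_j - (H 1)`_j).
have den j : bad j -> 0 < (H 0)`_j - (H 1)`_j.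
  by move=> bj; rewrite subr_gt0 (le_lt_trans bj) // F0.
have tr j : bad j -> t j \is Num.real.
  by move=> bj; rewrite ger0_real // divr_ge0 // ltW ?F0 ?den.
case: (@real_arg_minP _ _ (Ordinal ilt) bad t Gi tr) => j bj tmin.
have t0 : 0 <= t j by rewrite divr_ge0 // ltW ?F0 ?den.
have t1 : t j <= 1 by rewrite ler_pdivrMr ?den // mul1r lerDl oppr_ge0.
have Hj : (H (t j))`_j = 0.
  by rewrite HE /t; field; rewrite gt_eqF // den.
have t1' : t j < 1 \/ t j = 1 by move: t1; rewrite le_eqVlt => /predU1P[]; auto.
have H0 : 0 < (H (t j))`_0.
  have n0 : (0 < size f)%N by rewrite size_poly_gt0 monic_neq0.
  rewrite HE; case: t1' => [t1'|->]; last by rewrite subrr mul0r add0r mul1r.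
  apply: ltr_wpDr; first by rewrite mulr_ge0 // ltW.
  by rewrite mulr_gt0 ?F0 // subr_gt0.
have := Hpos _ t0 t1 H0 _ j (ltn_ord j); rewrite Hj ltxx => /(_ _)/negP; apply=> // k.
have [klt|/small->//] := ltnP k (size f).
have F0k := F0 k klt; rewrite HE.
have [Gk|Gk] := real_ltP (real0 _) (Gr k).
  by rewrite addr_ge0 // mulr_ge0 ?subr_ge0 // ltW.
have := tmin (Ordinal klt) Gk.
rewrite {2}/t /= ler_pdivlMr ?(den (Ordinal klt) Gk) // => tk.
have -> : (1 - t j) * (H 0)`_k + t j * (H 1)`_k =
    (H 0)`_k - t j * ((H 0)`_k - (H 1)`_k) by ring.
by rewrite subr_ge0.
Qed.

(** * Real stable multiaffine functions *)

Section Multiaffine.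
Variables (C : numClosedFieldType) (m r : nat).
Implicit Types (G : 'M[C]_(m, r) -> C) (Z W X : 'M[C]_(m, r)).

(* For a multiaffine [G] this is the partial derivative with respect to the
   entry [(i, j)]. *)
Definition pdiff (i : 'I_m) (j : 'I_r) G Z : C :=
  G (Z + delta_mx i j) - G Z.

Definition multiaffine G :=
  forall Z (i : 'I_m) (j : 'I_r) (y : C),
    G (Z + y *: delta_mx i j) = G Z + y * pdiff i j G Z.

Lemma pdiffE i j G Z : pdiff i j G Z = G (Z + delta_mx i j) - G Z.
Proof. by []. Qed.

Lemma pdiffC i j k l G Z : pdiff i j (pdiff k l G) Z = pdiff k l (pdiff i j G) Z.
Proof.
have E : Z + delta_mx i j + delta_mx k l = Z + delta_mx k l + delta_mx i j.
  by rewrite addrAC.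
by rewrite /pdiff E; ring.
Qed.

Lemma pdiff_multiaffine i j G : multiaffine G -> multiaffine (pdiff i j G).
Proof.
move=> aG Z k l y; rewrite pdiffC !(pdiffE i j).
have -> : Z + y *: delta_mx k l + delta_mx i j = Z + delta_mx i j + y *: delta_mx k l.
  by rewrite addrAC.
by rewrite !aG; ring.
Qed.

Lemma pdiff_shift i j G Z y : multiaffine G ->
  pdiff i j G (Z + y *: delta_mx i j) = pdiff i j G Z.
Proof.
move=> aG; rewrite pdiffE.
have -> : Z + y *: delta_mx i j + delta_mx i j = Z + (y + 1) *: delta_mx i j.
  by rewrite scalerDl scale1r addrA.
by rewrite !aG; ring.
Qed.

Lemma multiaffine_sum (I : Type) (s : seq I) (a : I -> C) (H : I -> 'M[C]_(m, r) -> C) :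
    (forall i, multiaffine (H i)) ->
  multiaffine (fun Z => \sum_(i <- s) a i * H i Z).
Proof.
move=> aH Z k l y; rewrite /pdiff mulrBr !mulr_sumr -sumrB -big_split /=.
by apply: eq_bigr => i _; rewrite aH /pdiff; ring.
Qed.

(** For multiaffine [G], the directional derivative along [W]. *)
Definition ddiff W G Z : C :=
  \sum_(c : 'I_m * 'I_r) W c.1 c.2 * pdiff c.1 c.2 G Z.

Lemma ddiff_multiaffine W G : multiaffine G -> multiaffine (ddiff W G).
Proof. by move=> aG; apply: multiaffine_sum => c; apply: pdiff_multiaffine. Qed.

Lemma ddiffC W X G Z : ddiff W (ddiff X G) Z = ddiff X (ddiff W G) Z.
Proof.
have E (V Y : 'M[C]_(m, r)) : ddiff V (ddiff Y G) Z =
    \sum_c \sum_c' V c.1 c.2 * Y c'.1 c'.2 * pdiff c.1 c.2 (pdiff c'.1 c'.2 G) Z.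
  apply: eq_bigr => c _; rewrite {1}/pdiff /ddiff -sumrB mulr_sumr.
  by apply: eq_bigr => c' _; rewrite /pdiff; ring.
rewrite !E exchange_big /=; apply: eq_bigr => c _; apply: eq_bigr => c' _.
by rewrite pdiffC; ring.
Qed.

(** The entries of [W] are added one at a time: an entry [c] adds [W c.1 c.2 *: ('X * q)] to [p],
    where [q] is the restriction of [pdiff c.1 c.2 G]. *)
Lemma multiaffine_line G Z W : multiaffine G ->
  exists p : {poly C}, forall s,
    p.[s] = G (Z + s *: W) /\ p^`().[s] = ddiff W G (Z + s *: W).
Proof.
move=> aG.
have [p pE] : exists p : {poly C}, forall s,
    let V := Z + s *: \sum_(c : 'I_m * 'I_r) W c.1 c.2 *: delta_mx c.1 c.2 in
    p.[s] = G V /\ p^`().[s] = ddiff W G V.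
  rewrite /ddiff; elim: (index_enum _) G aG => [|c l IH] G aG.
    exists (G Z)%:P => s; rewrite !big_nil scaler0 addr0 hornerC.
    by rewrite derivC horner0.
  have [p pE] := IH G aG; have [q qE] := IH _ (pdiff_multiaffine c.1 c.2 aG).
  exists (p + W c.1 c.2 *: ('X * q)) => s.
  set V := Z + s *: \sum_(c <- l) W c.1 c.2 *: delta_mx c.1 c.2.
  have VE : Z + s *: \sum_(c <- c :: l) W c.1 c.2 *: delta_mx c.1 c.2 =
      V + (s * W c.1 c.2) *: delta_mx c.1 c.2.
    by rewrite big_cons scalerDr addrCA addrC scalerA.
  have [ps p's] := pE s; have [qs q's] := qE s.
  rewrite VE derivD derivZ derivM derivX mul1r !hornerE /= ps p's qs q's -/V.
  split; first by rewrite aG; ring.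
  rewrite big_cons pdiff_shift // mulrDr [LHS]addrCA; congr (_ + _).
  rewrite mulrA mulr_sumr -big_split /=; apply: eq_bigr => c' _.
  by rewrite (pdiff_multiaffine _ _ aG) pdiffC; ring.
exists p => s; have := pE s; rewrite /=.
suff -> : \sum_(c : 'I_m * 'I_r) W c.1 c.2 *: delta_mx c.1 c.2 = W by [].
by rewrite -(pair_bigA _ (fun i j => W i j *: delta_mx i j)) /= -matrix_sum_delta.
Qed.

(* The last clause makes convex combinations of the univariate restrictions
   keep their degree. *)
Record real_stable n G : Prop := RealStable {
  rs_affine : multiaffine G;
  rs_stable : forall Z, (forall i j, 0 < 'Im (Z i j)) -> G Z != 0;
  rs_conj : forall Z, G (map_mx Num.conj Z) = (G Z)^*;
  rs_monic : forall Z, exists p : {poly C},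
    [/\ p \is monic, size p = n.+1 & forall x, p.[x] = G (Z + const_mx x)] }.

Lemma pdiff_conj i j G : (forall Z, G (map_mx Num.conj Z) = (G Z)^*) ->
  forall Z, pdiff i j G (map_mx Num.conj Z) = (pdiff i j G Z)^*.
Proof.
move=> cG Z; rewrite /pdiff rmorphB /= -!cG map_mxD; congr (G (_ + _) - _).
by rewrite map_delta_mx.
Qed.

(* Otherwise the root [- G Z / pdiff i j G Z] of the affine function
   [y |-> G (Z + y e_ij)] would have nonnegative imaginary part. *)
Lemma pdiff_upper n G Z i j : real_stable n G -> (forall i j, 0 < 'Im (Z i j)) ->
  pdiff i j G Z = 0 \/ 'Im (pdiff i j G Z * (G Z)^*) < 0.
Proof.
move=> [aG sG _ _] Z0; have [->|b0] := eqVneq (pdiff i j G Z) 0; [by left|right].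
rewrite real_ltNge ?real0 ?Creal_Im //; apply/negP => ba.
set b := pdiff i j G Z in b0 ba; pose y := - (G Z / b).
have y0 : 0 <= 'Im y.
  have -> : y = (b * (G Z)^*)^* * - (b * b^*)^-1.
    by rewrite /y rmorphM /= conjCK; field; rewrite conjC_eq0 b0.
  rewrite mulrC ImMl ?rpredN ?rpredV ?ger0_real ?mul_conjC_ge0 //.
  by rewrite Im_conj mulrNN mulr_ge0 ?invr_ge0 ?mul_conjC_ge0.
have Zy k l : 0 < 'Im ((Z + y *: delta_mx i j) k l).
  rewrite !mxE; case: eqP => _ /=; last by rewrite mulr0 addr0.
  case: eqP => _ /=; last by rewrite mulr0 addr0.
  by rewrite mulr1 raddfD /= ltr_wpDr.
have := sG _ Zy; rewrite aG -/b /y => /eqP; apply.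
by field.
Qed.

(** The expectation of [G] when row [k] picks column [j] with probability [w j]. The factor [r]
    cancels the uniform weight [1 / r], which leaves [G] minus its derivative along row [k]. *)
Definition mix (k : 'I_m) (w : 'I_r -> C) G Z : C :=
  \sum_j w j * G (Z - r%:R *: delta_mx k j).

Lemma mixE k w G Z : multiaffine G -> \sum_j w j = 1 ->
  mix k w G Z = G Z - r%:R * \sum_j w j * pdiff k j G Z.
Proof.
move=> aG w1; rewrite -{1}[G Z]mul1r -{1}w1 mulr_suml mulr_sumr -sumrB.
by apply: eq_bigr => j _; rewrite -scaleNr aG; ring.
Qed.

(** At an upper zero of the average, multiplying by the conjugate of [G Z] and taking imaginary
    parts gives a zero sum of terms of one sign. By the strict case of [pdiff_upper] every
    [w j * pdiff k j G Z] vanishes, hence so does [G Z]. *)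
Lemma mix_real_stable n k w G : (forall j, 0 <= w j) -> \sum_j w j = 1 ->
  real_stable n G -> real_stable n (mix k w G).
Proof.
move=> w0 w1 sG; have [aG nG cG mG] := sG.
have r0 : (0 < r)%N.
  rewrite lt0n; apply/negP => /eqP r0; move: w1; rewrite big1 => [/esym/eqP|[i ir] _].
    by rewrite oner_eq0.
  by have : (i < 0)%N by rewrite -r0.
split.
- apply: multiaffine_sum => j Z i l y; rewrite addrAC aG /pdiff; congr (_ + _ * (G _ - _)).
  by rewrite addrAC.
- move=> Z Z0; rewrite mixE //; apply/eqP => E.
  have GZ := nG Z Z0.
  have : 'Im ((G Z - r%:R * \sum_j w j * pdiff k j G Z) * (G Z)^*) = 0.
    by rewrite E mul0r raddf0.
  have -> : (G Z - r%:R * \sum_j w j * pdiff k j G Z) * (G Z)^* =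
      G Z * (G Z)^* - r%:R * \sum_j w j * (pdiff k j G Z * (G Z)^*).
    rewrite mulrBl -mulrA mulr_suml; congr (_ - _ * _).
    by apply: eq_bigr => j _; rewrite mulrA.
  rewrite raddfB /= (Creal_ImP _ (ger0_real (mul_conjC_ge0 _))) sub0r ImMl ?realn //.
  rewrite raddf_sum /= -mulrN -sumrN => /eqP; rewrite mulf_eq0 pnatr_eq0 eqn0Ngt r0 /=.
  rewrite psumr_eq0 => [/allP H|j _]; last first.
    rewrite ImMl ?ger0_real // -mulrN mulr_ge0 // oppr_ge0.
    by have [->|/ltW//] := pdiff_upper k j sG Z0; rewrite mul0r raddf0.
  move/eqP: GZ; apply; move: E; rewrite big1 ?mulr0 ?subr0 // => j _.
  have := H j (mem_index_enum _); rewrite oppr_eq0 ImMl ?ger0_real // mulf_eq0.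
  move=> /orP[/eqP->|]; first by rewrite mul0r.
  by have [->|] := pdiff_upper k j sG Z0; rewrite ?mulr0 // lt_neqAle => /andP[/negbTE->].
- move=> Z; rewrite /mix rmorph_sum; apply: eq_bigr => j _.
  rewrite rmorphM /= geC0_conj // -cG; congr (_ * G _).
  by rewrite map_mxB map_mxZ map_delta_mx /= conjC_nat.
move=> Z; have [p pP] := fin_all_exists (fun j => mG (Z - r%:R *: delta_mx k j)).
pose q := \sum_j w j *: p j.
have qn : q`_n = 1.
  rewrite coef_sum -w1; apply: eq_bigr => j _; have [/monicP lp sp _] := pP j.
  by rewrite coefZ; move: lp; rewrite lead_coefE sp => ->; rewrite mulr1.
have sq : size q = n.+1.
  apply/eqP; rewrite eqn_leq; apply/andP; split.
    apply: (leq_trans (size_sum _ _ _)); apply/bigmax_leqP => j _.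
    by have [_ <- _] := pP j; rewrite size_scale_leq.
  rewrite ltnNge; apply/negP => /leq_sizeP/(_ _ (leqnn _)).
  by rewrite qn => /eqP; rewrite oner_eq0.
exists q; split=> //; first by rewrite monicE lead_coefE sq qn.
move=> x; rewrite horner_sum; apply: eq_bigr => j _; have [_ _ pE] := pP j.
by rewrite hornerZ pE addrAC.
Qed.

(** Stability excludes roots in the upper half-plane, and conjugation carries this to the lower
    one. *)
Lemma real_stable_roots n G Z (p : {poly C}) x : real_stable n G ->
    map_mx Num.conj Z = Z -> (forall x, p.[x] = G (Z + const_mx x)) ->
  root p x -> x \is Num.real.
Proof.
move=> [_ nG cG _] Zr pE xr; apply/Creal_ImP/eqP.
have Z0 i j : 'Im (Z i j) = 0.
  by apply/Creal_ImP; rewrite CrealE; have /matrixP/(_ i j) := Zr; rewrite mxE => ->.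
have up y : root p y -> 'Im y <= 0.
  rewrite real_leNgt ?real0 ?Creal_Im // => yr; apply/negP => y0.
  have Zy i j : 0 < 'Im ((Z + const_mx y) i j) by rewrite !mxE raddfD /= Z0 add0r.
  by have := nG _ Zy; rewrite -pE (rootP yr) eqxx.
rewrite eq_le up //= -oppr_le0 -Im_conj up //.
have cE : const_mx x^* = map_mx Num.conj (const_mx x : 'M[C]_(m, r)).
  by rewrite map_const_mx.
by rewrite rootE pE cE -{1}Zr -map_mxD cG -pE (rootP xr) conjC0.
Qed.

(** * Uniform averages and the selection of columns *)

Definition uniform : 'I_r -> C := fun=> r%:R^-1.

Definition uniform_mix (l : seq 'I_m) G := foldr (fun k => mix k uniform) G l.

Lemma uniform_ge0 j : 0 <= uniform j.
Proof. by rewrite invr_ge0. Qed.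

Lemma sum_uniform : (0 < r)%N -> \sum_j uniform j = 1.
Proof.
move=> r0; rewrite /uniform sumr_const card_ord -(mulr_natr (r%:R^-1)) mulVf //.
by rewrite pnatr_eq0 -lt0n.
Qed.

Lemma uniform_mix_real_stable n l G : (0 < r)%N -> real_stable n G ->
  real_stable n (uniform_mix l G).
Proof.
move=> r0 sG; elim: l => //= k l IH.
by apply: mix_real_stable => //; [exact: uniform_ge0 | exact: sum_uniform].
Qed.

(** Some term is positive at [x0] because the average is. The segment between them consists of
    averages with other weights, hence is real-rooted, and carries positivity beyond [x0] to that
    term. *)
Lemma select_column n k G Z x0 : (0 < r)%N -> real_stable n G ->
    map_mx Num.conj Z = Z -> x0 \is Num.real ->
    (forall x, x0 <= x -> 0 < mix k uniform G (Z + const_mx x)) ->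
  exists j, forall x, x0 <= x -> 0 < G (Z - r%:R *: delta_mx k j + const_mx x).
Proof.
move=> r0 sG Zr xr pos.
have Zjr j : map_mx Num.conj (Z - r%:R *: delta_mx k j) = Z - r%:R *: delta_mx k j.
  by rewrite map_mxB map_mxZ map_delta_mx /= conjC_nat Zr.
have x0r : map_mx Num.conj (const_mx x0) = const_mx x0 :> 'M[C]_(m, r).
  by rewrite map_const_mx /= conj_Creal.
have [j gj] : exists j, 0 < G (Z - r%:R *: delta_mx k j + const_mx x0).
  have [/existsP//|] := boolP [exists j, 0 < G (Z - r%:R *: delta_mx k j + const_mx x0)].
  rewrite negb_exists => /forallP npos; exfalso.
  have := pos x0 (lexx _); rewrite real_ltNge ?real0 //.
    move=> /negP; apply; rewrite /mix; apply: sumr_le0 => j _.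
    rewrite mulr_ge0_le0 ?uniform_ge0 // real_leNgt ?real0 // addrAC //.
    by apply/CrealP; rewrite -(rs_conj sG) map_mxD Zjr x0r.
  apply/CrealP; rewrite -(rs_conj (mix_real_stable k uniform_ge0 (sum_uniform r0) sG)).
  by rewrite map_mxD Zr x0r.
have [f [fm sf fE]] := rs_monic (mix_real_stable k uniform_ge0 (sum_uniform r0) sG) Z.
have [g [gm sg gE]] := rs_monic sG (Z - r%:R *: delta_mx k j).
exists j => x; rewrite -gE.
apply: (@real_rooted_segment_gt0 C f g x0) => //; last 2 first.
- by move=> y; rewrite fE; apply: pos.
- by rewrite gE.
- by rewrite sf sg.
move=> s s0 s1 y; pose w i := (1 - s) * uniform i + s * (i == j)%:R.
have ws0 i : 0 <= w i.
  by rewrite addr_ge0 // mulr_ge0 ?subr_ge0 ?uniform_ge0 // ler0n.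
have ws1 : \sum_i w i = 1.
  rewrite big_split /= -!mulr_sumr sum_uniform // (bigD1 j) //= eqxx big1 => [|i /negbTE->//].
  by rewrite addr0 !mulr1 subrK.
apply: (real_stable_roots (mix_real_stable k ws0 ws1 sG) Zr) => z.
rewrite hornerD !hornerZ fE gE /mix mulr_sumr.
rewrite (bigD1 j) //= [RHS](bigD1 j) //= /w eqxx addrAC; congr (_ + _).
  by rewrite mulr1 (addrAC Z) mulrA -mulrDl.
by apply: eq_bigr => i /negbTE->; rewrite mulr0 addr0 mulrA.
Qed.

Lemma select_columns n l G Z x0 : (0 < r)%N -> real_stable n G -> uniq l ->
    map_mx Num.conj Z = Z -> x0 \is Num.real ->
    (forall x, x0 <= x -> 0 < uniform_mix l G (Z + const_mx x)) ->
  exists f : 'I_m -> 'I_r, forall x, x0 <= x ->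
    0 < G (Z - r%:R *: \sum_(k <- l) delta_mx k (f k) + const_mx x).
Proof.
move=> r0 sG; elim: l Z => [|k l IH] Z /= ul Zr xr pos.
  by exists (fun=> Ordinal r0) => x xx0; rewrite big_nil scaler0 subr0 pos.
case/andP: ul => kl ul.
have [j jP] := select_column r0 (uniform_mix_real_stable l r0 sG) Zr xr pos.
have Zjr : map_mx Num.conj (Z - r%:R *: delta_mx k j) = Z - r%:R *: delta_mx k j.
  by rewrite map_mxB map_mxZ map_delta_mx /= conjC_nat Zr.
have [f fP] := IH _ ul Zjr xr jP.
(* As [k] is not in [l], this redefinition does not disturb the choices made on [l]. *)
exists (fun i => if i == k then j else f i) => x /fP.
rewrite big_cons eqxx scalerDr opprD addrA.
congr (0 < G (_ - _ *: _ + _)); rewrite big_seq [RHS]big_seq.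
by apply: eq_bigr => i il; case: eqP => // ik; rewrite -ik il in kl.
Qed.

(** * Points above the zeros and barrier functions *)

Definition nonneg_mx W := forall i j, 0 <= W i j.

Definition above G Z := forall W, nonneg_mx W -> 0 < G (Z + W).

(** The logarithmic derivative of [G] along [W]. *)
Definition barrier W G Z := ddiff W G Z / G Z.

Lemma nonneg_mx_conj W : nonneg_mx W -> map_mx Num.conj W = W.
Proof. by move=> W0; apply/matrixP => i j; rewrite mxE geC0_conj. Qed.

Lemma nonneg_mx0 : nonneg_mx 0.
Proof. by move=> i j; rewrite mxE. Qed.

Lemma nonneg_mxD W X : nonneg_mx W -> nonneg_mx X -> nonneg_mx (W + X).
Proof. by move=> W0 X0 i j; rewrite mxE addr_ge0. Qed.

Lemma nonneg_mxZ a W : 0 <= a -> nonneg_mx W -> nonneg_mx (a *: W).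
Proof. by move=> a0 W0 i j; rewrite mxE mulr_ge0. Qed.

Lemma above_shift G Z W : above G Z -> nonneg_mx W -> above G (Z + W).
Proof. by move=> aG W0 X X0; rewrite -addrA aG //; apply: nonneg_mxD. Qed.

Lemma above_gt0 G Z : above G Z -> 0 < G Z.
Proof. by move=> /(_ 0 nonneg_mx0); rewrite addr0. Qed.

Lemma ddiff_conj V G : nonneg_mx V -> (forall Z, G (map_mx Num.conj Z) = (G Z)^*) ->
  forall Z, ddiff V G (map_mx Num.conj Z) = (ddiff V G Z)^*.
Proof.
move=> V0 cG Z; rewrite /ddiff rmorph_sum; apply: eq_bigr => c _.
by rewrite rmorphM /= geC0_conj // pdiff_conj.
Qed.

(** With strictly positive imaginary parts this sums [pdiff_upper] with nonnegative weights. In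
    general, ['i * x] is added to all entries and the positive number [x] tends to [0]. *)
Lemma ddiff_upper n G V X : real_stable n G -> nonneg_mx V ->
  (forall i j, 0 <= 'Im (X i j)) -> 'Im (ddiff V G X * (G X)^*) <= 0.
Proof.
move=> sG V0 X0.
have open (Y : 'M[C]_(m, r)) : (forall i j, 0 < 'Im (Y i j)) ->
    'Im (ddiff V G Y * (G Y)^*) <= 0.
  move=> Y0; rewrite /ddiff mulr_suml raddf_sum /= sumr_le0 // => c _.
  rewrite -mulrA ImMl ?ger0_real // mulr_ge0_le0 //.
  by have [->|/ltW//] := pdiff_upper c.1 c.2 sG Y0; rewrite mul0r raddf0.
have aG := rs_affine sG.
have [p pE] := multiaffine_line X (const_mx 1) aG.
have [q qE] := multiaffine_line X (const_mx 1) (ddiff_multiaffine V aG).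
pose h := (q \Po ('i *: 'X)) * (pconj p \Po (- 'i *: 'X)).
have hE x : x^* = x -> h.[x] =
    ddiff V G (X + ('i * x) *: const_mx 1) * (G (X + ('i * x) *: const_mx 1))^*.
  move=> xr; rewrite /h hornerM !horner_comp horner_pconj !hornerZ !hornerX.
  by rewrite rmorphM rmorphN /= conjCi opprK xr (pE _).1 (qE _).1.
have := @Im_horner0_le0 C h 1 ltr01; rewrite hE ?conjC0 // mulr0 scale0r addr0; apply.
move=> x x0 _; rewrite hE; last by rewrite geC0_conj // ltW.
apply: open => i j.
by rewrite !mxE mulr1 raddfD /= ImMil (Creal_ReP _ (gtr0_real x0)) ltr_wpDl.
Qed.

(** If a partial derivative [D] were negative, moving by [G Z / - D] along its entry would reach a
    zero of [G] inside the orthant. *)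
Lemma above_ddiff_ge0 G Z V : multiaffine G ->
    (forall Z, G (map_mx Num.conj Z) = (G Z)^*) -> map_mx Num.conj Z = Z ->
  above G Z -> nonneg_mx V -> 0 <= ddiff V G Z.
Proof.
move=> aG cG Zr abG V0; apply: sumr_ge0 => c _; rewrite mulr_ge0 //.
set D := pdiff _ _ _ _; have Dr : D \is Num.real.
  by apply/CrealP; rewrite -(pdiff_conj _ _ cG) Zr.
rewrite real_leNgt ?real0 //; apply/negP => D0.
have G0 := above_gt0 abG.
have y0 : 0 <= G Z / - D by rewrite divr_ge0 ?ltW ?oppr_gt0.
have d0 : nonneg_mx ((G Z / - D) *: delta_mx c.1 c.2).
  by apply: nonneg_mxZ => // i j; rewrite mxE ler0n.
have := abG _ d0; rewrite aG -/D.
have -> : G Z + G Z / - D * D = 0 by field; rewrite lt_eqF.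
by rewrite ltxx.
Qed.

(** [D] is minus the derivative of [barrier V G] along [W] at [X]; [flip_convex] applies to the
    restrictions of [G] and [ddiff V G] to the line. *)
Lemma barrier_line n G Z V W t : real_stable n G -> map_mx Num.conj Z = Z ->
    above G Z -> nonneg_mx V -> nonneg_mx W -> 0 <= t ->
  let X := Z + t *: W in
  let D := (ddiff V G X * ddiff W G X - ddiff W (ddiff V G) X * G X) / G X ^+ 2 in
  0 <= D /\ t * D <= barrier V G Z - barrier V G X.
Proof.
move=> sG Zr abG V0 W0 t0; have aG := rs_affine sG.
have [p pE] := multiaffine_line Z W aG.
have [q qE] := multiaffine_line Z W (ddiff_multiaffine V aG).
have sW s : 0 <= s -> nonneg_mx (s *: W) by move=> s0; apply: nonneg_mxZ.
have sWr s : 0 <= s -> map_mx Num.conj (Z + s *: W) = Z + s *: W.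
  by move=> s0; rewrite map_mxD Zr nonneg_mx_conj //; apply: sW.
have ImZW s i j : 'Im ((Z + s *: W) i j) = 'Im s * W i j.
  rewrite !mxE raddfD /= (Creal_ImP (Z i j) _) ?add0r; last first.
    by apply/CrealP; have /matrixP/(_ i j) := Zr; rewrite mxE.
  by rewrite mulrC ImMl ?ger0_real // mulrC.
have fl : half_plane_flip p q.
  split=> s s0; rewrite (pE s).1 (qE s).1.
    by apply: ddiff_upper sG V0 _ => i j; rewrite ImZW mulr_ge0 // ltW.
  have cE : map_mx Num.conj (Z + s^* *: W) = Z + s *: W.
    by rewrite map_mxD map_mxZ /= conjCK Zr nonneg_mx_conj.
  rewrite -cE (ddiff_conj V0 (rs_conj sG)) (rs_conj sG) -rmorphM /= Im_conj oppr_ge0.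
  by apply: ddiff_upper sG V0 _ => i j; rewrite ImZW Im_conj mulr_ge0 // oppr_ge0 ltW.
have hp s : 0 <= s -> p.[s] != 0.
  by move=> s0; rewrite (pE s).1 gt_eqF // abG //; apply: sW.
have hq s : 0 <= s -> 0 <= q.[s] / p.[s].
  move=> s0; have ab := above_shift abG (sW s s0).
  rewrite (pE s).1 (qE s).1 divr_ge0 //; last exact: ltW (above_gt0 ab).
  exact: above_ddiff_ge0 (rs_conj sG) (sWr s s0) ab V0.
have := flip_convex fl hp hq (lexx 0) t0; rewrite /= subr0.
rewrite (pE t).1 (pE t).2 (qE t).1 (qE t).2 (pE 0).1 (qE 0).1.
by rewrite scale0r addr0.
Qed.

Lemma barrier_le n G Z V W : real_stable n G -> map_mx Num.conj Z = Z ->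
    above G Z -> nonneg_mx V -> nonneg_mx W ->
  barrier V G (Z + W) <= barrier V G Z.
Proof.
move=> sG Zr abG V0 W0; have := barrier_line sG Zr abG V0 W0 ler01.
rewrite /= scale1r mul1r => -[D0 /(le_trans D0)].
by rewrite subr_ge0.
Qed.

(* Let [D] be minus the derivative of [barrier V G] along [W] at [Z + d *: W].
   Replacing [G] by [H] adds [D / (1 - barrier W G)] to the barrier; this is at
   most [d * D], which convexity gained in the move from [Z]. *)
Lemma barrier_step n G (H : 'M[C]_(m, r) -> C) Z W d :
    real_stable n G -> map_mx Num.conj Z = Z ->
    above G Z -> nonneg_mx W -> 0 < d -> barrier W G Z <= 1 - d^-1 ->
    (forall X, H X = G X - ddiff W G X) ->
  above H (Z + d *: W) /\
  forall V, nonneg_mx V -> barrier V H (Z + d *: W) <= barrier V G Z.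
Proof.
move=> sG Zr abG W0 d0 bG HE.
have dW : nonneg_mx (d *: W) by apply: nonneg_mxZ => //; apply: ltW.
have d'0 : 0 < d^-1 by rewrite invr_gt0.
(* Barriers do not increase in the orthant, so the quotient [H / G = 1 - barrier W G] stays at least
   [d^-1] there. *)
have HP U : nonneg_mx U -> d^-1 <= 1 - barrier W G (Z + U).
  move=> U0; rewrite lerBrDr -lerBrDl.
  exact: le_trans (barrier_le sG Zr abG W0 U0) bG.
split=> [T T0|V V0].
  rewrite -addrA HE; have U0 := nonneg_mxD dW T0.
  have G0 : 0 < G (Z + (d *: W + T)) by apply: abG.
  have := lt_le_trans d'0 (HP _ U0).
  have -> : 1 - barrier W G (Z + (d *: W + T)) =
      (G (Z + (d *: W + T)) - ddiff W G (Z + (d *: W + T))) / G (Z + (d *: W + T)).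
    by rewrite /barrier; field; rewrite gt_eqF.
  by rewrite pmulr_lgt0 // invr_gt0.
have [] := barrier_line sG Zr abG V0 W0 (ltW d0).
set X := Z + d *: W; set D := _ / _ => D0 dD.
have G0 : 0 < G X := abG _ dW.
have HX := HP _ dW; rewrite -/X in HX.
have ddH : ddiff V H X = ddiff V G X - ddiff W (ddiff V G) X.
  rewrite [ddiff W _ _]ddiffC /ddiff -sumrB; apply: eq_bigr => c _.
  by rewrite /pdiff !HE /ddiff; ring.
have a0 : 0 < 1 - barrier W G X := lt_le_trans d'0 HX.
have -> : barrier V H X = barrier V G X + D / (1 - barrier W G X).
  have nz : G X - ddiff W G X != 0.
    move: (gt_eqF a0) => /negbT; apply: contra => /eqP E.
    by rewrite /barrier -[ddiff W G X](subKr (G X)) E subr0 divff ?subrr // gt_eqF.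
  have nzG : G X != 0 by rewrite gt_eqF.
  have aE : 1 - barrier W G X = (G X - ddiff W G X) / G X.
    by rewrite mulrBl divff.
  rewrite aE /barrier ddH HE /D.
  move: nz nzG; move: (G X) (ddiff W G X) (ddiff V G X) (ddiff W (ddiff V G) X).
  by move=> x y z u nz nzG; field; rewrite nz nzG.
have : D / (1 - barrier W G X) <= d * D.
  by rewrite ler_pdivrMr // mulrC mulrA ler_peMl // -ler_pdivrMr // mul1r.
by move=> DD; rewrite addrC -lerBrDr (le_trans DD).
Qed.

Definition row_one (k : 'I_m) : 'M[C]_(m, r) := \matrix_(i, j) (i == k)%:R.

Lemma ddiff_row_one k G Z : ddiff (row_one k) G Z = \sum_j pdiff k j G Z.
Proof.
rewrite /ddiff -(pair_bigA _ (fun i j => row_one k i j * pdiff i j G Z)) /=.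
rewrite (bigD1 k) //= [X in _ + X]big1 ?addr0 => [|i /negbTE ik].
  by apply: eq_bigr => j _; rewrite mxE eqxx mul1r.
by rewrite big1 // => j _; rewrite mxE ik mul0r.
Qed.

(** The common bound on all row barriers is the induction invariant, preserved by [barrier_step] at
    each averaged row. *)
Lemma uniform_mix_above n l G (t d : C) : (0 < r)%N -> real_stable n G ->
    0 < d -> t \is Num.real -> above G (const_mx t) ->
    (forall k, barrier (row_one k) G (const_mx t) <= 1 - d^-1) ->
  let Z := const_mx t + d *: \sum_(k <- l) row_one k in
  above (uniform_mix l G) Z /\
  forall k, barrier (row_one k) (uniform_mix l G) Z <= 1 - d^-1.
Proof.
move=> r0 sG d0 tr abG bG /=.
have e0 k : nonneg_mx (row_one k) by move=> i j; rewrite mxE ler0n.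
elim: l => [|k l [IHa IHb]] /=; first by rewrite big_nil scaler0 addr0.
set Z := const_mx t + _ in IHa IHb.
have Zr : map_mx Num.conj Z = Z.
  rewrite map_mxD map_const_mx /= conj_Creal // nonneg_mx_conj //.
  apply: nonneg_mxZ (ltW d0) _; elim/big_ind: _ => //; first exact: nonneg_mx0.
  exact: nonneg_mxD.
have sl := uniform_mix_real_stable l r0 sG.
have mE X : mix k uniform (uniform_mix l G) X =
    uniform_mix l G X - ddiff (row_one k) (uniform_mix l G) X.
  rewrite mixE ?sum_uniform //; last exact: rs_affine sl.
  rewrite ddiff_row_one -mulr_sumr mulrA mulfV ?mul1r //.
  by rewrite pnatr_eq0 -lt0n.
have [] := barrier_step sl Zr IHa (e0 k) d0 (IHb k) mE.
rewrite big_cons scalerDr addrCA addrC => ab b.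
by split=> // j; apply: le_trans (b _ (e0 j)) (IHb j).
Qed.

Lemma uniform_mix_gt0 n G (t d x : C) : (0 < r)%N -> real_stable n G ->
    0 < d -> t \is Num.real -> above G (const_mx t) ->
    (forall k, barrier (row_one k) G (const_mx t) <= 1 - d^-1) ->
  t + d <= x -> 0 < uniform_mix (enum 'I_m) G (const_mx x).
Proof.
move=> r0 sG d0 tr abG bG tdx.
have [ab _] := uniform_mix_above (enum 'I_m) r0 sG d0 tr abG bG.
have sE : \sum_(k <- enum 'I_m) row_one k = const_mx 1.
  apply/matrixP => i j; rewrite summxE mxE big_enum /= (bigD1 i) //= mxE eqxx.
  by rewrite big1 ?addr0 // => k /negbTE ki; rewrite mxE eq_sym ki.
have -> : const_mx x =
    const_mx t + d *: \sum_(k <- enum 'I_m) row_one k + const_mx (x - (t + d)).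
  by apply/matrixP => i j; rewrite sE !mxE; ring.
by apply: ab => i j; rewrite mxE subr_ge0.
Qed.

End Multiaffine.

(** * The determinantal polynomial *)

Section RankOne.
Variables (F : fieldType) (d : nat).
Implicit Types (M : 'M[F]_d) (a : 'cV[F]_d) (b : 'rV[F]_d).

(** Elimination shows that the bordered matrix [K z] has determinant [\det (M + z *: (a *m b))], and
    [z] enters only its last row, affinely. *)
Lemma det_add_rank1 M a b (y : F) :
  \det (M + y *: (a *m b)) = \det M + y * (\det (M + a *m b) - \det M).
Proof.
pose K z := block_mx M (- a) (z *: b) (1%:M : 'M[F]_1).
have KE z : \det (K z) = \det (M + z *: (a *m b)).
  have : \det (K z *m block_mx 1%:M 0 (- (z *: b)) 1%:M) = \det (M + z *: (a *m b)).
    rewrite mulmx_block !mulmx1 !mulmx0 !mul1mx !add0r mulNmx mulmxN opprK -scalemxAr subrr.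
    by rewrite det_ublock det1 mulr1.
  by rewrite det_mulmx det_lblock !det1 !mulr1.
have <- : \det (K 0) = \det M by rewrite KE scale0r addr0.
have <- : \det (K 1) = \det (M + a *m b) by rewrite KE scale1r.
rewrite -KE.
pose i0 : 'I_(d + 1) := rshift d 0.
have rw' z : row' i0 (K z) = row' i0 (K 0).
  apply/matrixP => i j; rewrite [LHS]mxE [RHS]mxE /K /block_mx.
  have [k ->|k ik] := split_ordP (lift i0 i); first by rewrite !col_mxEu.
  by have := neq_lift i0 i; rewrite ik (ord1 k) eqxx.
rewrite (@determinant_multilinear _ _ (K y) (K 1) (K 0) i0 y (1 - y)) ?rw' //.
  by ring.
have KE' z l : row i0 (K z) 0 l = row_mx (z *: b) 1%:M 0 l.
  by rewrite mxE /K /block_mx col_mxEd.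
apply/rowP => j; rewrite KE'; transitivity (y * row i0 (K 1) 0 j + (1 - y) * row i0 (K 0) 0 j).
  rewrite !KE'; have [k ->|k ->] := split_ordP j; rewrite ?row_mxEl ?row_mxEr ?mxE; ring.
by rewrite !mxE.
Qed.

(** Multiplying [K] by one unitriangular matrix on either side gives two block triangular matrices,
    whose determinants are the two sides. *)
Lemma det1_add_rank1 a b : \det (1%:M + a *m b) = 1 + (b *m a) 0 0.
Proof.
pose K := block_mx 1%:M (- a) b (1%:M : 'M[F]_1).
have -> : \det (1%:M + a *m b) = \det (K *m block_mx 1%:M 0 (- b) 1%:M).
  rewrite mulmx_block !mulmx1 !mulmx0 !mul1mx !add0r mulNmx mulmxN opprK subrr.
  by rewrite det_ublock det1 mulr1.
have : \det (block_mx 1%:M 0 (- b) 1%:M *m K) = 1 + (b *m a) 0 0.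
  rewrite mulmx_block !mulmx1 !mul0mx !mul1mx !addr0 mulNmx mulmxN opprK addNr.
  by rewrite det_ublock det1 mul1r det_mx11 !mxE eqxx addrC.
by rewrite !det_mulmx mulrC.
Qed.

End RankOne.

(** On an eigenvector the form is the eigenvalue times a positive squared norm; the determinant is
    the product of the eigenvalues. *)
Lemma pos_def_det_gt0 (C : numClosedFieldType) d (M : 'M[C]_d) :
    (forall v : 'rV_d, v != 0 -> 0 < (v *m M *m v^t*) 0 0) -> 0 < \det M.
Proof.
move=> Mpd; have [rs] := closed_field_poly_normal (char_poly M).
rewrite (monicP (char_poly_monic M)) scale1r => rsE.
have rs0 z : z \in rs -> 0 < z.
  move=> zrs; have : root (char_poly M) z by rewrite rsE root_prod_XsubC.
  rewrite -eigenvalue_root_char => /eigenvalueP[v vM v0].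
  have := Mpd v v0; rewrite vM -scalemxAl mxE pmulr_lgt0 //.
  by rewrite -dotmxE dnorm_gt0.
have sz : size rs = d by have := size_char_poly M; rewrite rsE size_prod_XsubC => -[].
have := char_poly_det M; rewrite rsE -horner_coef0 horner_prod.
under eq_bigr => z _ do rewrite hornerXsubC sub0r -mulN1r.
rewrite big_split /= big_const_seq count_predT iter_mulr_1 sz => /(mulfI _) <-; last first.
  by rewrite signr_eq0.
by rewrite big_seq prodr_gt0.
Qed.

Lemma horner_char_poly (C : comNzRingType) d (M : 'M[C]_d) x :
  (char_poly M).[x] = \det (x%:M - M).
Proof.
rewrite /char_poly -[_.[x]]/(horner_eval x _) -det_map_mx; congr (\det _).
by apply/matrixP => i j; rewrite !mxE /= horner_evalE hornerD hornerN hornerC hornerMn hornerX.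
Qed.

Section DetProduct.
Variables (C : numClosedFieldType) (m r d : nat) (u : 'I_m -> 'cV[C]_d).
Implicit Types (Z : 'M[C]_(m, r)) (v : 'rV[C]_d).
Hypothesis u1 : \sum_i u i *m (u i)^t* = 1%:M.

Definition pencil Z j := \sum_i Z i j *: (u i *m (u i)^t*).

Definition det_prod Z := \prod_j \det (pencil Z j).

Lemma pencil_form Z j v : (v *m pencil Z j *m v^t*) 0 0 =
  \sum_i Z i j * ((v *m u i) 0 0 * ((v *m u i) 0 0)^*).
Proof.
rewrite /pencil mulmx_sumr mulmx_suml summxE; apply: eq_bigr => i _.
rewrite -scalemxAr -scalemxAl mxE; congr (_ * _).
have -> : v *m (u i *m (u i)^t*) *m v^t* = v *m u i *m (v *m u i)^t*.
  by rewrite trmx_mul map_mxM !mulmxA.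
by rewrite {1}[v *m u i]mx11_scalar mul_scalar_mx !mxE.
Qed.

Lemma pencilD Z W j : pencil (Z + W) j = pencil Z j + pencil W j.
Proof.
by rewrite /pencil -big_split; apply: eq_bigr => i _; rewrite mxE scalerDl.
Qed.

Lemma pencil_const x j : pencil (const_mx x) j = x%:M.
Proof.
rewrite -scalemx1 -u1 /pencil scaler_sumr; apply: eq_bigr => i _.
by rewrite mxE.
Qed.

Lemma pencil_delta k l j y : pencil (y *: delta_mx k l) j =
  (if j == l then y else 0) *: (u k *m (u k)^t*).
Proof.
rewrite /pencil (bigD1 k) //= big1 ?addr0 => [|i ik].
  by rewrite !mxE eqxx /=; case: eqP; rewrite ?mulr1 ?mulr0.
by rewrite !mxE (negbTE ik) /= mulr0 scale0r.
Qed.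

Lemma det_prod_delta Z k l y : det_prod (Z + y *: delta_mx k l) =
  \det (pencil Z l + y *: (u k *m (u k)^t*)) * \prod_(j | j != l) \det (pencil Z j).
Proof.
rewrite /det_prod (bigD1 l) //= pencilD pencil_delta eqxx; congr (_ * _).
by apply: eq_bigr => j /negbTE jl; rewrite pencilD pencil_delta jl scale0r addr0.
Qed.

Lemma unit_form_neq0 v : v != 0 -> exists i, (v *m u i) 0 0 != 0.
Proof.
move=> v0; apply/existsP; apply: contraNT v0; rewrite negb_exists => /forallP H.
rewrite -[v]mulmx1 -u1 mulmx_sumr big1 // => i _; rewrite mulmxA.
have := H i; rewrite negbK => /eqP vu.
by rewrite [v *m u i]mx11_scalar vu mul_scalar_mx scale0r.
Qed.

(** Affinity is the rank-one determinant formula. A kernel vector at an upper [Z] would annihilate a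
    form whose imaginary part is positive. Conjugating [Z] replaces each pencil by its adjoint, and
    adding [const_mx x] adds [x%:M], which produces characteristic polynomials. *)
Lemma det_prod_real_stable : real_stable (r * d) det_prod.
Proof.
split.
- move=> Z k l y; have := det_prod_delta Z k l 1; rewrite !scale1r => E.
  have ZE := bigD1 l (F := fun j => \det (pencil Z j)) (erefl : xpredT l).
  rewrite pdiffE E det_prod_delta [det_prod Z]ZE det_add_rank1 /=; ring.
- move=> Z Z0; apply/prodf_neq0 => j _; apply/negP => /det0P[v v0 vZ].
  have [i vi] := unit_form_neq0 v0.
  have := pencil_form Z j v; rewrite vZ mul0mx mxE => /(congr1 (fun x => 'Im x)).
  have re z : z * z^* \is @Num.real C by rewrite ger0_real // mul_conjC_ge0.
  rewrite raddf0 raddf_sum /= => /esym/eqP; rewrite psumr_eq0.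
    move/allP/(_ i (mem_index_enum _)); rewrite mulrC ImMl // mulf_eq0 mul_conjC_eq0.
    by rewrite (negbTE vi) gt_eqF.
  by move=> k _; rewrite mulrC ImMl // mulr_ge0 ?mul_conjC_ge0 // ltW.
- move=> Z; rewrite /det_prod rmorph_prod; apply: eq_bigr => j _.
  rewrite -det_map_mx -det_tr; congr (\det _); rewrite /pencil map_mx_sum linear_sum /=.
  apply: eq_bigr => i _; rewrite map_mxZ linearZ /= mxE; congr (_ *: _).
  by rewrite map_mxM trmx_mul; congr (_ *m _); apply/matrixP => k l; rewrite !mxE /= ?conjCK.
move=> Z; exists (\prod_j char_poly (- pencil Z j)); split.
- by apply: monic_prod => j _; apply: char_poly_monic.
- rewrite size_prod => [|j _]; last by rewrite monic_neq0 ?char_poly_monic.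
  under eq_bigr => j _ do rewrite size_char_poly.
  by rewrite sum_nat_const card_ord mulnS -addnS addKn.
move=> x; rewrite horner_prod; apply: eq_bigr => j _.
by rewrite horner_char_poly opprK pencilD pencil_const addrC.
Qed.

Lemma det_prod_above t : 0 < t -> above det_prod (const_mx t).
Proof.
move=> t0 W W0; apply: prodr_gt0 => j _; apply: pos_def_det_gt0 => v v0.
have [i vi] := unit_form_neq0 v0; rewrite pencil_form (bigD1 i) //= ltr_wpDr //.
  by apply: sumr_ge0 => k _; rewrite mulr_ge0 ?mul_conjC_ge0 // !mxE addr_ge0 // ltW.
by rewrite mulr_gt0 ?mul_conjC_gt0 // !mxE ltr_wpDr.
Qed.

(** At a constant matrix every pencil is [t%:M], and by [det1_add_rank1] each of the [r] columns
    contributes the squared norm of [u k] over [t]. *)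
Lemma det_prod_barrier t k : 0 < t ->
  barrier (row_one C r k) det_prod (const_mx t) = r%:R * (((u k)^t* *m u k) 0 0) / t.
Proof.
move=> t0; have tn0 : t != 0 by rewrite gt_eqF.
have G0 : det_prod (const_mx t) != 0 by rewrite gt_eqF // (above_gt0 (det_prod_above t0)).
rewrite /barrier ddiff_row_one mulr_suml.
rewrite (eq_bigr (fun=> ((u k)^t* *m u k) 0 0 / t)) => [|j _].
  by rewrite sumr_const card_ord -[LHS]mulr_natl mulrA.
have GE : det_prod (const_mx t) =
    \det (t%:M : 'M[C]_d) * \prod_(i < r | i != j) \det (pencil (const_mx t) i).
  by rewrite /det_prod (bigD1 j) //= pencil_const.
rewrite /pdiff -[delta_mx k j]scale1r det_prod_delta scale1r pencil_const.
have -> : t%:M + u k *m (u k)^t* = t *: (1%:M + u k *m (t^-1 *: (u k)^t*)).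
  by rewrite scalerDr scalemx1 -scalemxAr scalerA mulfV // scale1r.
rewrite detZ det1_add_rank1 -scalemxAl mxE.
move: G0; rewrite {}GE det_scalar.
move: (\prod_(_ | _) _) (t ^+ d) => P Q /[!mulf_eq0] /[!negb_or] /andP[Q0 P0].
by field; rewrite tn0 Q0 P0.
Qed.

Lemma partition_det_neq0 (e : C) : (0 < r)%N -> 0 < e ->
    (forall k, r%:R * ((u k)^t* *m u k) 0 0 <= e ^+ 2) ->
  exists f : 'I_m -> 'I_r, forall j x, (1 + e) ^+ 2 <= x ->
    \det (x%:M - r%:R *: \sum_(i | f i == j) u i *m (u i)^t*) != 0.
Proof.
move=> r0 e0 ue; have e1 : 0 < 1 + e by rewrite addr_gt0.
(* This [t] makes [(1 - (1 + e)^-1) * t] equal to [e ^+ 2], as the barrier bound asks, and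
   [t + (1 + e)] equal to [(1 + e) ^+ 2]. *)
pose t := e + e ^+ 2; have t0 : 0 < t by rewrite addr_gt0 // exprn_gt0.
have bar k : barrier (row_one C r k) det_prod (const_mx t) <= 1 - (1 + e)^-1.
  rewrite det_prod_barrier // ler_pdivrMr //.
  have -> : (1 - (1 + e)^-1) * t = e ^+ 2 by rewrite /t; field; rewrite gt_eqF.
  exact: ue.
have tE : t + (1 + e) = (1 + e) ^+ 2 by rewrite /t; ring.
have pos x : (1 + e) ^+ 2 <= x -> 0 < uniform_mix (enum 'I_m) det_prod (0 + const_mx x).
  rewrite add0r -tE; apply: uniform_mix_gt0 r0 det_prod_real_stable e1 _ (det_prod_above t0) bar.
  exact: gtr0_real.
have [||f fP] := select_columns r0 det_prod_real_stable (enum_uniq _) _ _ pos.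
- by rewrite map_mx0.
- by rewrite gtr0_real // exprn_gt0.
exists f => j x /fP /gt_eqF/negbT; rewrite add0r => /prodf_neq0/(_ j isT).
rewrite pencilD pencil_const addrC; congr (\det (_ + _) != 0).
rewrite /pencil -!scaleNr [RHS]scaler_sumr [RHS]big_mkcond; apply: eq_bigr => i _.
have -> : (- r%:R *: \sum_(k <- enum 'I_m) delta_mx k (f k)) i j =
    - r%:R * (f i == j)%:R :> C.
  rewrite mxE summxE big_enum /= (bigD1 i) //= mxE eqxx /= eq_sym big1 ?addr0 // => k ki.
  by rewrite mxE eq_sym (negbTE ki).
by case: eqP; rewrite ?mulr1 // mulr0 scale0r.
Qed.

End DetProduct.

(** * From nonvanishing determinants to norm bounds *)

Lemma mulmx_tC_form (C : numClosedFieldType) d (y : 'cV[C]_d) :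
  (y^t* *m y) 0 0 = \sum_k `|y k 0| ^+ 2.
Proof. by rewrite mxE; apply: eq_bigr => k _; rewrite !mxE normCKC. Qed.

(** Positivity and the nonvanishing determinants confine the eigenvalues to the interval from [0] to
    [c]; a unitary change of basis then reduces the bound to a diagonal matrix. *)
Lemma psd_norm_le (C : numClosedFieldType) d (N : 'M[C]_d) (c : C) (x : 'cV[C]_d) :
    N^t* = N -> (forall v : 'rV_d, 0 <= (v *m N *m v^t*) 0 0) -> 0 <= c ->
    (forall y, c <= y -> \det (y%:M - N) != 0) ->
  ((N *m x)^t* *m (N *m x)) 0 0 <= c ^+ 2 * (x^t* *m x) 0 0.
Proof.
move=> Nh Npsd c0 Ndet.
have Nn : N \is normalmx by apply/normalmxP; rewrite Nh.
have NE := orthomx_spectralP Nn; set P := spectralmx N in NE.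
set D := spectral_diag N in NE.
have Pu : P \is unitarymx := spectral_unitarymx N.
have PP : P *m P^t* = 1%:M by apply/unitarymxP.
have Pun : P \in unitmx := spectral_unit N.
have D0 k : 0 <= D 0 k.
  have := Npsd (row k P); have -> : (row k P *m N *m (row k P)^t*) 0 0 = (P *m N *m P^t*) k k.
    by rewrite -row_mul !mxE; apply: eq_bigr => l _; rewrite !mxE.
  rewrite [in P *m N]NE !mulmxA mulmxV // mul1mx -mulmxA PP mulmx1.
  by rewrite mxE eqxx mulr1n.
have Dc k : D 0 k <= c.
  rewrite real_leNgt ?ger0_real //; apply/negP => cD.
  have /negP := Ndet _ (ltW cD); apply.
  have -> : (D 0 k)%:M - N = invmx P *m ((D 0 k)%:M - diag_mx D) *m P.
    rewrite mulmxBr mulmxBl -NE; congr (_ - _).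
    by rewrite scalar_mxC mulmxKV.
  rewrite !det_mulmx mulf_eq0 mulf_eq0; apply/orP; left; apply/orP; right.
  rewrite -diag_const_mx -raddfB /= det_diag; apply/prodf_eq0; exists k => //.
  by rewrite !mxE subrr.
pose y := P *m x.
have PP' : P^t* *m P = 1%:M by rewrite -invmx_unitary ?mulVmx.
have -> : x^t* *m x = y^t* *m y.
  by rewrite trmx_mul map_mxM mulmxA -[_ *m P^t* *m P]mulmxA PP' mulmx1.
have -> : (N *m x)^t* *m (N *m x) = (diag_mx D *m y)^t* *m (diag_mx D *m y).
  have -> : N *m x = P^t* *m (diag_mx D *m y) by rewrite {1}NE invmx_unitary // !mulmxA.
  move: (diag_mx D *m y) => z; rewrite trmx_mul map_mxM trmxCK mulmxA.
  by rewrite -[_ *m P *m P^t*]mulmxA PP mulmx1.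
rewrite !mulmx_tC_form mulr_sumr; apply: ler_sum => k _.
rewrite mul_diag_mx mxE normrM exprMn ger0_norm //.
by rewrite ler_wpM2r ?exprn_ge0 // lerXn2r ?nnegrE.
Qed.

(** * Euclidean and operator norms *)

Lemma enorm_form (R : realType) d (x : 'cV[R[i]]_d) :
  (x^t* *m x) 0 0 = (enorm x ^+ 2)%:C%C.
Proof.
rewrite mulmx_tC_form /enorm sqr_sqrtr ?sumr_ge0 // => [|k _]; last exact: sqr_ge0.
by rewrite rmorph_sum; apply: eq_bigr => k _; rewrite rmorphXn.
Qed.

(** The assumption [0 <= c] covers the empty unit sphere, whose supremum is [0]. *)
Lemma opnorm_le (R : realType) d (M : 'M[R[i]]_d) (c : R) : 0 <= c ->
  (forall x, enorm x = 1 -> enorm (M *m x) <= c) -> opnorm M <= c.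
Proof.
move=> c0 Mc; rewrite /opnorm; set E := [set _ | _ in _]%classic.
have [->|/set0P E0] := eqVneq E set0; first by rewrite sup0.
by apply: ge_sup => // _ [x x1 <-]; apply: Mc.
Qed.

Theorem corollary1p5 (R : realType) (r m d : nat) (delta : R)
    (u : 'I_m -> 'cV[R[i]]_d) :
  (0 < r)%N ->
  \sum_(i < m) u i *m (u i)^t* = 1%:M ->
  (forall i : 'I_m, enorm (u i) ^+ 2 <= delta) ->
  exists S : 'I_r -> {set 'I_m},
    [/\ \bigcup_(j < r) S j = [set: 'I_m]%SET,
        forall j k : 'I_r, j != k -> [disjoint S j & S k] &
        forall j : 'I_r,
          opnorm (\sum_(i in S j) u i *m (u i)^t*)
            <= ((Num.sqrt (r%:R))^-1 + Num.sqrt delta) ^+ 2].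
Proof.
move=> r0 u1 ud; set c := _ ^+ 2.
have c0 : 0 <= c by apply: sqr_ge0.
suff [f fP] : exists f : 'I_m -> 'I_r, forall j x, enorm x = 1 ->
    enorm ((\sum_(i | f i == j) u i *m (u i)^t*) *m x) <= c.
  exists (fun j => [set i | f i == j]%SET); split.
  - apply/setP => i; rewrite inE; apply/bigcupP; exists (f i) => //.
    by rewrite inE.
  - move=> j k jk; rewrite finset.disjoints_subset; apply/fintype.subsetP => i.
    by rewrite !inE => /eqP->.
  - move=> j; apply: opnorm_le c0 _ => x x1.
    by rewrite (eq_bigl (fun i => f i == j)) ?fP // => i; rewrite inE.
have [d0|dn0] := posnP d.
  exists (fun=> Ordinal r0) => j x; rewrite /enorm big1 ?sqrtr0 => [/eqP|[k kd]].
    by rewrite eq_sym oner_eq0.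
  by exfalso; move: kd; rewrite d0.
(* Otherwise every [u i] vanishes and the identity matrix has trace [0], although [d] is
   positive. *)
have delta0 : 0 < delta.
  rewrite ltNge; apply/negP => dle0.
  have : \tr (\sum_i u i *m (u i)^t*) = 0.
    rewrite raddf_sum big1 // => i _ /=; rewrite mxtrace_mulC /mxtrace big_ord1 enorm_form.
    suff -> : enorm (u i) ^+ 2 = 0 by [].
    by apply: le_anti; rewrite sqr_ge0 (le_trans (ud i)).
  by rewrite u1 mxtrace1 => /eqP; rewrite pnatr_eq0 eqn0Ngt dn0.
have rR : 0 < r%:R :> R by rewrite ltr0n.
pose e := Num.sqrt (r%:R * delta).
have e0 : 0 < e by rewrite sqrtr_gt0 mulr_gt0.
have eE : e ^+ 2 = r%:R * delta by rewrite sqr_sqrtr // mulr_ge0 // ltW.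
(* The root bound for [r] times the partial sums, divided by [r], is exactly the claimed
   constant. *)
have cE : r%:R * c = (1 + e) ^+ 2.
  rewrite /e sqrtrM ?ltW // /c -{1}(sqr_sqrtr (ltW rR)).
  by field; rewrite gt_eqF // sqrtr_gt0.
have e0C : 0 < e%:C%C by rewrite ltcR.
have ueC k : r%:R * ((u k)^t* *m u k) 0 0 <= (e%:C%C : R[i]) ^+ 2.
  rewrite enorm_form -rmorphXn eE -(rmorph_nat (real_complex R)) -rmorphM /= lecR.
  by rewrite ler_pM2l.
have [f fP] := partition_det_neq0 u1 r0 e0C ueC.
exists f => j x x1; set N := \sum_(_ | _) _.
have NE : N = pencil u (\matrix_(i < m, k < r) (f i == k)%:R) j.
  rewrite /N /pencil big_mkcond; apply: eq_bigr => i _; rewrite mxE.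
  by case: eqP; rewrite ?scale1r ?scale0r.
have Nh : N^t* = N.
  rewrite /N [X in map_mx _ X]linear_sum map_mx_sum; apply: eq_bigr => i _ /=.
  by rewrite trmx_mul map_mxM trmxCK.
have Npsd (v : 'rV[R[i]]_d) : 0 <= (v *m N *m v^t*) 0 0.
  rewrite NE (pencil_form u); apply: sumr_ge0 => i _.
  by rewrite mulr_ge0 ?mul_conjC_ge0 // mxE ler0n.
have cC : 0 <= c%:C%C by rewrite lecR.
have rC : r%:R != 0 :> R[i] by rewrite pnatr_eq0 -lt0n.
have Ndet y : c%:C%C <= y -> \det (y%:M - N) != 0.
  move=> cy; have := fP j (r%:R * y); rewrite -/N.
  have -> : (r%:R * y)%:M - r%:R *: N = r%:R *: (y%:M - N).
    by rewrite scalerBr scale_scalar_mx.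
  rewrite detZ mulf_eq0 negb_or => H; suff /H/andP[] : (1 + e%:C%C) ^+ 2 <= r%:R * y by [].
  rewrite -(rmorph1 (real_complex R)) -rmorphD -rmorphXn /= -cE rmorphM rmorph_nat.
  by rewrite ler_wpM2l // ler0n.
have := psd_norm_le x Nh Npsd cC Ndet.
rewrite !enorm_form x1 expr1n mulr1 -rmorphXn lecR.
by rewrite ler_pXn2r // nnegrE sqrtr_ge0.
Qed.
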